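(* Let $d<\infty$, let $V\subset\mathbb{B}_d$ be an analytic disc attached to the unit sphere and $f$ its embedding map. Suppose $f(\xi)=f(\zeta)$ for two distinct $\xi,\zeta\in\mathbb{T}$. If $\varphi\in\mathcal{M}_f$ extends continuously to $\overline{\mathbb{D}}$, then $\varphi(\xi)=\varphi(\zeta)$.
   Context: $\mathbb{D}$ is the open unit disc, $\mathbb{T}$ the unit circle, $\mathbb{B}_d$ the open unit ball of $\mathbb{C}^d$. The Drury–Arveson space $H^2_d$ is the RKHS on $\mathbb{B}_d$ with kernel $1/(1-\langle z,w\rangle)$, with multiplier algebra $\mathcal{M}_d$. A variety is a common zero set in $\mathbb{B}_d$ of a family of functions from $\mathcal{M}_d$. An analytic disc attached to the unit sphere is a variety $V\subset\mathbb{B}_d$ ($d<\infty$) for which there is an injective analytic $f:\mathbb{D}\to\mathbb{B}_d$ with $f'(z)\neq0$ on $\mathbb{D}$, $V=f(\mathbb{D})$, $f$ extends to a $C^2$ map on $\overline{\mathbb{D}}$, and for $x\in\overline{\mathbb{D}}$, $\|f(x)\|=1$ iff $|x|=1$ ($f$ is the embedding map). $\mathcal{H}_f$ is the RKHS on $\mathbb{D}$ with kernel $k^f(z,w)=1/(1-\langle f(z),f(w)\rangle)$ and $\mathcal{M}_f$ its multiplier algebra. *)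

(* Defs.v *)
From Stdlib Require Import Reals List.
From Coquelicot Require Import Coquelicot.
Import ListNotations.

Local Open Scope R_scope.

Fixpoint csum (n : nat) (a : nat -> C) : C :=
  match n with
  | O => RtoC 0
  | S m => Cplus (csum m a) (a m)
  end.

(** Points of C^d are represented as padded sequences v : nat -> C with
    v i = 0 for i >= d. *)
Definition is_vec (d : nat) (v : nat -> C) : Prop :=
  forall i, (d <= i)%nat -> v i = RtoC 0.

Definition cinner (d : nat) (z w : nat -> C) : C :=
  csum d (fun i => Cmult (z i) (Cconj (w i))).

Definition vnorm2 (d : nat) (z : nat -> C) : R := fst (cinner d z z).

Definition ball_d (d : nat) (z : nat -> C) : Prop := is_vec d z /\ vnorm2 d z < 1.

Definition open_disc (z : C) : Prop := Cmod z < 1.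
Definition closed_disc (z : C) : Prop := Cmod z <= 1.
Definition unit_circle (z : C) : Prop := Cmod z = 1.

(** ** Reproducing kernel Hilbert spaces (Moore--Aronszajn construction).
    Given a set dom (a predicate on a type X) and a kernel K on dom, an element
    of the span of the kernel functions k_w = K(., w) is coded by a finite list
    of pairs (a_j, w_j), meaning  sum_j a_j k_{w_j}. *)
Section RKHS.
Context {X : Type}.

Definition span_eval (K : X -> X -> C) (l : list (C * X)%type) (z : X) : C :=
  fold_right (fun p acc => Cplus (Cmult (fst p) (K z (snd p))) acc) (RtoC 0) l.

Definition span_norm2 (K : X -> X -> C) (l : list (C * X)%type) : R :=
  fst (fold_right (fun pi acc =>
         Cplus (fold_right (fun pj acc' =>
                  Cplus (Cmult (Cmult (fst pj) (Cconj (fst pi))) (K (snd pi) (snd pj))) acc')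
                (RtoC 0) l) acc)
       (RtoC 0) l).

Definition span_sub (l m : list (C * X)%type) : list (C * X)%type :=
  l ++ map (fun p => (Copp (fst p), snd p)) m.

(** h belongs to the RKHS H_K on dom: h is the pointwise limit on dom of a
    norm-Cauchy sequence of elements of span { k_w : w in dom }
    (i.e. h is an element of the completion of that span). *)
Definition in_RKHS (dom : X -> Prop) (K : X -> X -> C) (h : X -> C) : Prop :=
  exists g : nat -> list (C * X)%type,
    (forall n, List.Forall (fun p => dom (snd p)) (g n)) /\
    (forall eps : R, 0 < eps -> exists N : nat, forall n m : nat,
        (N <= n)%nat -> (N <= m)%nat -> span_norm2 K (span_sub (g n) (g m)) < eps) /\
    (forall z, dom z -> filterlim (fun n => span_eval K (g n) z) eventually (locally (h z))).

Definition multiplier (dom : X -> Prop) (K : X -> X -> C) (phi : X -> C) : Prop :=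
  forall h, in_RKHS dom K h -> in_RKHS dom K (fun z => Cmult (phi z) (h z)).
End RKHS.

Definition DA_kernel (d : nat) (z w : nat -> C) : C :=
  Cinv (Cminus (RtoC 1) (cinner d z w)).

Definition in_Md (d : nat) (phi : (nat -> C) -> C) : Prop :=
  multiplier (ball_d d) (DA_kernel d) phi.

Definition is_variety (d : nat) (V : (nat -> C) -> Prop) : Prop :=
  exists S : ((nat -> C) -> C) -> Prop,
    (forall g, S g -> in_Md d g) /\
    (forall v, V v <-> (ball_d d v /\ forall g, S g -> g v = RtoC 0)).

Definition C2_on_R2 (U : R -> R -> Prop) (g : R -> R -> R) : Prop :=
  exists gx gy gxx gxy gyx gyy : R -> R -> R,
    forall x y, U x y ->
      is_derive (fun t => g t y) x (gx x y) /\ is_derive (fun t => g x t) y (gy x y) /\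
      is_derive (fun t => gx t y) x (gxx x y) /\ is_derive (fun t => gx x t) y (gxy x y) /\
      is_derive (fun t => gy t y) x (gyx x y) /\ is_derive (fun t => gy x t) y (gyy x y) /\
      (forall h, In h [g; gx; gy; gxx; gxy; gyx; gyy] ->
         continuous (fun p : R * R => h (fst p) (snd p)) (x, y)).

Definition C2_map_on (d : nat) (U : C -> Prop) (F : C -> nat -> C) : Prop :=
  forall i, (i < d)%nat ->
    C2_on_R2 (fun x y => U (x, y)) (fun x y => fst (F (x, y) i)) /\
    C2_on_R2 (fun x y => U (x, y)) (fun x y => snd (F (x, y) i)).

Definition embedding_map (d : nat) (f : C -> nat -> C) : Prop :=
  (forall x, closed_disc x -> is_vec d (f x)) /\
  (forall z, open_disc z -> forall i, (i < d)%nat ->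
      ex_derive (K := C_AbsRing) (V := C_NormedModule) (fun w => f w i) z) /\
  (forall z, open_disc z -> exists i, (i < d)%nat /\ exists l : C,
      is_derive (K := C_AbsRing) (V := C_NormedModule) (fun w => f w i) z l /\ l <> RtoC 0) /\
  (forall z w, open_disc z -> open_disc w -> (forall i, f z i = f w i) -> z = w) /\
  (forall z, open_disc z -> ball_d d (f z)) /\
  (exists (U : C -> Prop) (F : C -> nat -> C),
      open U /\ (forall x, closed_disc x -> U x) /\
      (forall x, closed_disc x -> forall i, F x i = f x i) /\ C2_map_on d U F) /\
  (forall x, closed_disc x -> (vnorm2 d (f x) = 1 <-> Cmod x = 1)).

Definition kf (d : nat) (f : C -> nat -> C) (z w : C) : C :=
  Cinv (Cminus (RtoC 1) (cinner d (f z) (f w))).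

Definition in_Mf (d : nat) (f : C -> nat -> C) (phi : C -> C) : Prop :=
  multiplier open_disc (kf d f) phi.

(* Main.v *)
Require Import Defs.
From Stdlib Require Import Reals Lra Lia List ClassicalEpsilon.
From Coquelicot Require Import Coquelicot.
Import ListNotations.
Local Open Scope R_scope.

(** Let [p = f xi = f zeta].  The harmonic function [Re <f, p>] is maximal at [xi], so by
    the Hopf lemma and the Cauchy-Riemann equations the radial derivative of [<f, p>] at
    [xi] is a positive real [A]; likewise [B] at [zeta].  For [z_t = (1 - t / A) xi] and
    [w_t = (1 - t / B) zeta] the numbers [t k(z_t, z_t)], [t k(w_t, w_t)] and
    [t k(z_t, w_t)] all tend to [1 / 2], hence [q_t = t ||k_(z_t) - k_(w_t)||^2 -> 0].

    For [h] in the space, [|h(z_t) - h(w_t)|^2 <= C_h q_t / t].  Applying this to [h] and to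
    [phi h] gives [|phi(z_t) - phi(w_t)|^2 t |h(z_t)|^2 <= C q_t].  If [phi(xi) <> phi(zeta)],
    this is contradicted by [h = sum_j 2^-j sqrt(t_j) k_(z_(t_j))] with [q_(t_j) <= 16^-j]:
    since [Re k >= 0], [sqrt(t_j) |h(z_(t_j))|] is at least [2^-j / 4].  This replaces the
    closed graph theorem for the multiplication operator. *)

(** [in_Mf] only says that multiplication by [phi] preserves the space; no norm bound comes with it.
    For a bounded operator, the adjoint would send [k_z] to [conj (phi z) k_z], and nearly parallel
    kernels would force nearly equal values of [phi]. Here each function [h] has its own constant
    [C_h], so one [h] has to be large at all chosen points at once. The weights [2^-j] make its
    series converge and cost [4^-j] after squaring, which the rate [16^-j] still beats.

    The value [1 / 2] arises as follows: after normalisation [<f(z_t), p>] and [<f(w_t), p>] are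
    both [1 - t + o(t)], and the pairing of the two displacements from [p] is of second order, so
    [<f(z_t), f(w_t)> = 1 - 2 t + o(t)] whatever the tangent directions of the two branches. It
    matters that [A] and [B] are real: unequal imaginary parts after normalisation would survive in
    the cross term and push its real part below [1 / 2]. Smoothness up to the circle is what lets
    the Cauchy-Riemann equations be used at [xi] itself. *)

Lemma C_ext (a b : C) : fst a = fst b -> snd a = snd b -> a = b.
Proof. destruct a, b; simpl; congruence. Qed.

Lemma Cmod_sqr (c : C) : Cmod c ^ 2 = fst c ^ 2 + snd c ^ 2.
Proof. unfold Cmod. rewrite pow2_sqrt; nra. Qed.

Lemma Rle_of_sqr_le (a b : R) : 0 <= b -> a ^ 2 <= b ^ 2 -> a <= b.
Proof. intros Hb H. apply Rnot_lt_le. intros Hc. nra. Qed.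

Lemma Re_le_Cmod (c : C) : fst c <= Cmod c.
Proof.
  apply Rle_of_sqr_le; [apply Cmod_ge_0|]. rewrite Cmod_sqr. nra.
Qed.

(** Taken by coordinates so that the limit lemmas for real sequences apply; [Clim_seq_filterlim]
    links it to the filter limits in [in_RKHS] and in the continuity hypothesis. *)
Definition Clim_seq (u : nat -> C) (l : C) : Prop :=
  is_lim_seq (fun n => fst (u n)) (fst l) /\ is_lim_seq (fun n => snd (u n)) (snd l).

Lemma Clim_seq_filterlim (u : nat -> C) (l : C) :
  Clim_seq u l <-> filterlim u eventually (locally l).
Proof.
  split.
  - intros [H1 H2].
    apply (filterlim_ext (fun n => (fst (u n), snd (u n)))).
    { intros n. now destruct (u n). }
    destruct l as [a b]. intros P [eps HP].
    pose proof (H1 _ (locally_ball a eps)) as Q1.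
    pose proof (H2 _ (locally_ball b eps)) as Q2.
    unfold filtermap in *. generalize (filter_and _ _ Q1 Q2).
    apply filter_imp. intros n [A B]. apply HP. now split.
  - intros H. split.
    + apply filterlim_comp with (1 := H) (f := u). destruct l.
      apply (continuous_fst (U := R_UniformSpace) (V := R_UniformSpace)).
    + apply filterlim_comp with (1 := H) (f := u). destruct l.
      apply (continuous_snd (U := R_UniformSpace) (V := R_UniformSpace)).
Qed.

Lemma Clim_seq_const (c : C) : Clim_seq (fun _ => c) c.
Proof. split; apply is_lim_seq_const. Qed.

Lemma Clim_seq_plus (u v : nat -> C) (a b : C) :
  Clim_seq u a -> Clim_seq v b -> Clim_seq (fun n => Cplus (u n) (v n)) (Cplus a b).
Proof. intros [] []; split; simpl; now apply is_lim_seq_plus'. Qed.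

Lemma Clim_seq_mult (u v : nat -> C) (a b : C) :
  Clim_seq u a -> Clim_seq v b -> Clim_seq (fun n => Cmult (u n) (v n)) (Cmult a b).
Proof.
  intros [] []; split; simpl.
  - apply is_lim_seq_minus'; now apply is_lim_seq_mult'.
  - apply is_lim_seq_plus'; now apply is_lim_seq_mult'.
Qed.

Lemma Clim_seq_Cmod_minus_sqr (u v : nat -> C) (a b : C) :
  Clim_seq u a -> Clim_seq v b ->
  is_lim_seq (fun n => Cmod (Cminus (u n) (v n)) ^ 2) (Cmod (Cminus a b) ^ 2).
Proof.
  intros [A1 A2] [B1 B2]. rewrite Cmod_sqr.
  eapply is_lim_seq_ext; [intros n; symmetry; apply Cmod_sqr|]. simpl.
  apply is_lim_seq_plus'; repeat apply is_lim_seq_mult';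
    try apply is_lim_seq_const; now apply is_lim_seq_minus'.
Qed.

(** * Kernel forms *)

Section KernelForm.
Context {X : Type}.
Implicit Types (K : X -> X -> C) (l m : list (C * X)).

(** By the reproducing property this is the inner product of the two coded elements, linear in [l]
    and antilinear in [m]. Going through [span_eval] shows that [l] enters only through the function
    it codes. *)
Definition span_form K l m : C :=
  fold_right (fun q acc => Cplus (Cmult (Cconj (fst q)) (span_eval K l (snd q))) acc)
    (RtoC 0) m.

Definition span_scale (c : C) l : list (C * X) :=
  map (fun p => (Cmult c (fst p), snd p)) l.

Definition hermitian K : Prop := forall z w, K z w = Cconj (K w z).

Definition in_span (dom : X -> Prop) l : Prop := List.Forall (fun p => dom (snd p)) l.

Definition positive_semidefinite (dom : X -> Prop) K : Prop :=
  forall l, in_span dom l -> 0 <= span_norm2 K l.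

Lemma span_norm2_form K l : span_norm2 K l = fst (span_form K l l).
Proof.
  unfold span_norm2, span_form. f_equal.
  assert (E : forall (a : C) w l', fold_right (fun pj acc' =>
      Cplus (Cmult (Cmult (fst pj) (Cconj a)) (K w (snd pj))) acc') (RtoC 0) l'
      = Cmult (Cconj a) (span_eval K l' w)).
  { intros a w l'. induction l' as [|p l' IH]; simpl; [ring|]. rewrite IH. ring. }
  (* Only the two outer lists are generalised; the inner ones must stay fixed during the
     induction. *)
  generalize l at 2 4 as l0. induction l0 as [|p l0 IH]; simpl; [easy|].
  now rewrite IH, E.
Qed.

Lemma span_eval_app K l m z :
  span_eval K (l ++ m) z = Cplus (span_eval K l z) (span_eval K m z).
Proof. induction l as [|p l IH]; simpl; [ring|]. rewrite IH. ring. Qed.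

Lemma span_eval_scale K c l z :
  span_eval K (span_scale c l) z = Cmult c (span_eval K l z).
Proof. induction l as [|p l IH]; simpl; [ring|]. rewrite IH. ring. Qed.

Lemma span_sub_scale l m : span_sub l m = l ++ span_scale (Copp (RtoC 1)) m.
Proof.
  unfold span_sub, span_scale. f_equal. apply map_ext. intros p. f_equal. ring.
Qed.

Lemma span_eval_sub K l m z :
  span_eval K (span_sub l m) z = Cminus (span_eval K l z) (span_eval K m z).
Proof. rewrite span_sub_scale, span_eval_app, span_eval_scale. ring. Qed.

Lemma span_form_eval_ext K l l' m :
  (forall z, span_eval K l z = span_eval K l' z) -> span_form K l m = span_form K l' m.
Proof. intros H. induction m as [|q m IH]; simpl; [easy|]. now rewrite IH, H. Qed.

Lemma span_form_app_l K l l' m :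
  span_form K (l ++ l') m = Cplus (span_form K l m) (span_form K l' m).
Proof.
  induction m as [|q m IH]; simpl; [ring|]. rewrite IH, span_eval_app. ring.
Qed.

Lemma span_form_scale_l K c l m :
  span_form K (span_scale c l) m = Cmult c (span_form K l m).
Proof.
  induction m as [|q m IH]; simpl; [ring|]. rewrite IH, span_eval_scale. ring.
Qed.

Lemma span_form_conj K l m :
  hermitian K -> span_form K m l = Cconj (span_form K l m).
Proof.
  intros HK. induction m as [|q m IH]; simpl.
  - induction l as [|p l IHl]; simpl; [apply C_ext; simpl; ring|].
    rewrite IHl. apply C_ext; simpl; ring.
  - rewrite Cplus_conj, <- IH, Cmult_conj, Cconj_conj. clear IH.
    induction l as [|p l IHl]; simpl; [apply C_ext; simpl; ring|].
    rewrite IHl, Cplus_conj, Cmult_conj, <- HK. ring.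
Qed.

(** A function has many codes. Each slot of the form sees a code only through its values, conjugate
    symmetry exchanging the slots, so cancellations inside [span_sub] can be checked pointwise. *)
Lemma span_norm2_ext K l l' :
  hermitian K -> (forall z, span_eval K l z = span_eval K l' z) ->
  span_norm2 K l = span_norm2 K l'.
Proof.
  intros HK H. rewrite !span_norm2_form.
  rewrite (span_form_eval_ext _ _ _ _ H), span_form_conj by easy.
  now rewrite (span_form_eval_ext _ _ _ _ H), <- span_form_conj.
Qed.

Lemma span_norm2_add_scale K l m c : hermitian K ->
  span_norm2 K (l ++ span_scale c m) =
  span_norm2 K l + 2 * fst (Cmult (Cconj c) (span_form K l m))
  + Cmod c ^ 2 * span_norm2 K m.
Proof.
  intros HK. rewrite !span_norm2_form, span_form_app_l, span_form_scale_l.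
  rewrite (span_form_conj K (l ++ span_scale c m) l) by easy.
  rewrite (span_form_conj K (l ++ span_scale c m) m) by easy.
  rewrite !span_form_app_l, !span_form_scale_l, (span_form_conj K l m) by easy.
  assert (E : snd (span_form K l l) = 0 /\ snd (span_form K m m) = 0).
  { split;
    [pose proof (span_form_conj K l l HK) as E | pose proof (span_form_conj K m m HK) as E];
    apply (f_equal snd) in E; simpl in E; lra. }
  revert E. rewrite Cmod_sqr. generalize (span_form K l l) (span_form K m m) (span_form K l m).
  intros [a1 a2] [b1 b2] [e1 e2]. simpl. intros [-> ->]. ring.
Qed.

Lemma in_span_app dom l m : in_span dom l -> in_span dom m -> in_span dom (l ++ m).
Proof. intros. now apply Forall_app. Qed.

Lemma in_span_scale dom c l : in_span dom l -> in_span dom (span_scale c l).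
Proof. intros. apply Forall_map. simpl. exact H. Qed.

Lemma span_Cauchy_Schwarz dom K l m :
  hermitian K -> positive_semidefinite dom K -> in_span dom l -> in_span dom m ->
  Cmod (span_form K l m) ^ 2 <= span_norm2 K l * span_norm2 K m.
Proof.
  intros HK HP Hl Hm. set (B := span_form K l m).
  (* Testing positivity on [l - t B m] with real [t] turns the cross term into [- 2 t |B|^2] and
     leaves a real quadratic in [t]. *)
  assert (Q : forall t : R,
    0 <= span_norm2 K l - 2 * t * Cmod B ^ 2 + t ^ 2 * Cmod B ^ 2 * span_norm2 K m).
  { intros t. pose proof (HP (l ++ span_scale (Cmult (RtoC (- t)) B) m)) as H.
    rewrite span_norm2_add_scale in H by easy. fold B in H.
    rewrite Cmod_mult, Cmod_R, Rpow_mult_distr, <- Rsqr_pow2, <- Rsqr_abs, Rsqr_pow2 in H.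
    rewrite Cmod_sqr in *. simpl in *.
    specialize (H (in_span_app _ _ _ Hl (in_span_scale _ _ _ Hm))). nra. }
  pose proof (HP l Hl) as Pl. pose proof (HP m Hm) as Pm.
  revert Q Pl Pm. generalize (span_norm2 K l) (span_norm2 K m).
  assert (P : 0 <= Cmod B ^ 2) by apply pow2_ge_0. revert P.
  generalize (Cmod B ^ 2). intros b P x y Q Px [Py|Py].
  - specialize (Q (/ y)). assert (E : / y * y = 1) by (field; lra).
    apply Rmult_le_compat_r with (r := y) in Q; [|lra].
    replace ((x - 2 * / y * b + (/ y) ^ 2 * b * y) * y) with (x * y - b) in Q
      by (field; lra). lra.
  (* Semidefiniteness allows [m] to have norm zero. The quadratic is then affine in [t], and
     [t = (x + 1) / (2 b)] would give it the value [-1] unless [b = 0]. *)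
  - subst y. destruct P as [P|P]; [|subst b; lra].
    specialize (Q ((x + 1) / (2 * b))).
    replace (2 * ((x + 1) / (2 * b)) * b) with (x + 1) in Q by (field; lra). lra.
Qed.

Lemma Cmod_plus_sqr_le (a b : C) : Cmod (Cplus a b) ^ 2 <= 2 * Cmod a ^ 2 + 2 * Cmod b ^ 2.
Proof.
  rewrite !Cmod_sqr. destruct a as [x y], b as [x' y']. simpl.
  pose proof (pow2_ge_0 (x - x')). pose proof (pow2_ge_0 (y - y')). lra.
Qed.

(** The difference [h z - h w] is the pairing of [h] with [k_z - k_w], coded by [m]. Cauchy-Schwarz
    bounds it for the approximants [g n], uniformly in [n] because a Cauchy sequence is bounded, and
    the bound passes to the pointwise limit. *)
Lemma RKHS_difference_bound dom K h :
  hermitian K -> positive_semidefinite dom K -> in_RKHS dom K h ->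
  exists M, 0 <= M /\ forall z w, dom z -> dom w ->
    Cmod (Cminus (h z) (h w)) ^ 2 <=
    M * (fst (K z z) + fst (K w w) - 2 * fst (K z w)).
Proof.
  intros HK HP (g & Hg & Hc & Hl).
  destruct (Hc 1 Rlt_0_1) as [N HN].
  (* For [n >= N] the squared distance from [g n] to [g N] is below 1; the factors 2 come from
     [Cmod_plus_sqr_le]. *)
  exists (2 + 2 * span_norm2 K (g N)).
  split; [pose proof (HP _ (Hg N)); lra|].
  intros z w Hz Hw.
  set (m := [(RtoC 1, z); (Copp (RtoC 1), w)]).
  assert (Hm : in_span dom m) by (repeat constructor; easy).
  assert (Em : span_norm2 K m = fst (K z z) + fst (K w w) - 2 * fst (K z w)).
  { unfold span_norm2, m. simpl. rewrite (HK w z). simpl. ring. }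
  rewrite <- Em.
  assert (F : forall l, span_form K l m = Cminus (span_eval K l z) (span_eval K l w)).
  { intros l. unfold m. simpl. apply C_ext; simpl; ring. }
  assert (B : forall n, (N <= n)%nat ->
    Cmod (Cminus (span_eval K (g n) z) (span_eval K (g n) w)) ^ 2 <=
    (2 + 2 * span_norm2 K (g N)) * span_norm2 K m).
  { intros n Hn. rewrite <- F.
    assert (Hsub : in_span dom (span_sub (g n) (g N))).
    { rewrite span_sub_scale. apply in_span_app; [|apply in_span_scale]; apply Hg. }
    replace (span_form K (g n) m) with
      (Cplus (span_form K (span_sub (g n) (g N)) m) (span_form K (g N) m)).
    2:{ rewrite !F, !span_eval_sub. ring. }
    eapply Rle_trans; [apply Cmod_plus_sqr_le|].
    pose proof (span_Cauchy_Schwarz dom K _ m HK HP Hsub Hm) as C1.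
    pose proof (span_Cauchy_Schwarz dom K _ m HK HP (Hg N) Hm) as C2.
    pose proof (HN n N Hn (le_n N)) as Q. pose proof (HP m Hm) as Q'.
    nra. }
  assert (L : is_lim_seq
    (fun n => Cmod (Cminus (span_eval K (g n) z) (span_eval K (g n) w)) ^ 2)
    (Cmod (Cminus (h z) (h w)) ^ 2)).
  { apply Clim_seq_Cmod_minus_sqr; apply Clim_seq_filterlim; auto. }
  assert (L' := is_lim_seq_const ((2 + 2 * span_norm2 K (g N)) * span_norm2 K m)).
  refine (is_lim_seq_le_loc _ _ _ _ _ L L').
  now exists N.
Qed.

End KernelForm.

(** * Positive semidefiniteness of the kernel *)

Section PositiveKernels.
Context {X : Type} (dom : X -> Prop).
Implicit Types (K : X -> X -> C) (l m : list (C * X)).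

Lemma positive_semidefinite_ext K K' :
  (forall z w, K z w = K' z w) -> positive_semidefinite dom K ->
  positive_semidefinite dom K'.
Proof.
  intros E HK l Hl. specialize (HK l Hl). rewrite span_norm2_form in *.
  replace (span_form K' l l) with (span_form K l l); [easy|].
  assert (E' : forall z, span_eval K l z = span_eval K' l z).
  { intros z. clear Hl HK. induction l as [|p l IH]; simpl; [easy|]. now rewrite IH, E. }
  assert (F : forall m, span_form K l m = span_form K' l m); [|easy].
  intros m. induction m as [|p m IH]; simpl; [easy|]. now rewrite IH, E'.
Qed.

Lemma positive_semidefinite_plus K K' :
  positive_semidefinite dom K -> positive_semidefinite dom K' ->
  positive_semidefinite dom (fun z w => Cplus (K z w) (K' z w)).
Proof.
  intros H H' l Hl. specialize (H l Hl). specialize (H' l Hl).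
  rewrite span_norm2_form in *.
  replace (span_form _ l l) with (Cplus (span_form K l l) (span_form K' l l)).
  { simpl. lra. }
  assert (E : forall z, Cplus (span_eval K l z) (span_eval K' l z) =
    span_eval (fun z w => Cplus (K z w) (K' z w)) l z).
  { intros z. clear. induction l as [|p l IH]; simpl; [ring|]. rewrite <- IH. ring. }
  assert (F : forall m, Cplus (span_form K l m) (span_form K' l m) =
    span_form (fun z w => Cplus (K z w) (K' z w)) l m); [|easy].
  intros m. induction m as [|p m IH]; simpl; [ring|]. rewrite <- IH, <- E. ring.
Qed.

Lemma positive_semidefinite_zero : positive_semidefinite dom (fun _ _ => RtoC 0).
Proof.
  intros l _. rewrite span_norm2_form. right.
  assert (E : forall m, span_form (fun _ _ : X => RtoC 0) l m = RtoC 0); [|now rewrite E].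
  assert (E : forall z, span_eval (fun _ _ : X => RtoC 0) l z = RtoC 0).
  { intros z. induction l as [|p l IH]; simpl; [easy|]. rewrite IH. ring. }
  intros m. induction m as [|p m IH]; simpl; [easy|]. rewrite IH, E. ring.
Qed.

Lemma positive_semidefinite_one : positive_semidefinite dom (fun _ _ => RtoC 1).
Proof.
  intros l _. rewrite span_norm2_form.
  set (S := span_eval (fun _ _ : X => RtoC 1) l).
  assert (E : forall z m, span_form (fun _ _ : X => RtoC 1) l m =
     Cmult (S z) (Cconj (span_eval (fun _ _ : X => RtoC 1) m z))).
  { intros z m. induction m as [|p m IH].
    - simpl. apply C_ext; simpl; ring.
    - cbn [span_form fold_right span_eval]. unfold span_form in IH. rewrite IH.
      fold (span_eval (fun _ _ : X => RtoC 1) m z).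
      rewrite Cplus_conj, Cmult_conj. replace (Cconj (RtoC 1)) with (RtoC 1).
      2:{ apply C_ext; simpl; ring. }
      (* For a constant kernel the evaluation point disappears by conversion, so it may be exchanged
         freely. *)
      change (span_eval (fun _ _ : X => RtoC 1) l (snd p)) with (S z). ring. }
  (* Factoring the form as [S z] times its conjugate needs some point [z]; a nonempty list supplies
     one. *)
  assert (Hz : l = [] \/ exists _ : X, True).
  { destruct l as [|p l]; [now left | right; now exists (snd p)]. }
  destruct Hz as [-> | [z _]]; [simpl; lra|].
  rewrite (E z l). fold S. destruct (S z) as [a b]. simpl. nra.
Qed.

(** The rank-one case of the Schur product theorem: the factors [g] are absorbed into the
    coefficients. It suffices here because the inner product of [C^d] is a finite sum of rank-one
    kernels. *)
Lemma positive_semidefinite_conj_mult K (g : X -> C) :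
  positive_semidefinite dom K ->
  positive_semidefinite dom (fun z w => Cmult (Cmult (g z) (Cconj (g w))) (K z w)).
Proof.
  intros HK l Hl.
  set (r := map (fun p : C * X => (Cmult (fst p) (Cconj (g (snd p))), snd p))).
  assert (Hr : in_span dom (r l)) by (apply Forall_map; simpl; exact Hl).
  specialize (HK _ Hr). rewrite span_norm2_form in *.
  replace (span_form _ l l) with (span_form K (r l) (r l)); [easy|].
  assert (E : forall z, Cmult (g z) (span_eval K (r l) z) =
    span_eval (fun z w => Cmult (Cmult (g z) (Cconj (g w))) (K z w)) l z).
  { intros z. clear. induction l as [|p l IH]; simpl; [ring|]. rewrite <- IH. ring. }
  assert (F : forall m, span_form K (r l) (r m) =
    span_form (fun z w => Cmult (Cmult (g z) (Cconj (g w))) (K z w)) l m); [|easy].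
  intros m. induction m as [|p m IH]; simpl; [ring|].
  rewrite IH, <- E, Cmult_conj, Cconj_conj. ring.
Qed.

Lemma positive_semidefinite_lim (Kn : nat -> X -> X -> C) K :
  (forall n, positive_semidefinite dom (Kn n)) ->
  (forall z w, dom z -> dom w -> Clim_seq (fun n => Kn n z w) (K z w)) ->
  positive_semidefinite dom K.
Proof.
  intros HP HL l Hl.
  assert (E : forall z, dom z -> Clim_seq (fun n => span_eval (Kn n) l z) (span_eval K l z)).
  { intros z Hz. clear HP. induction Hl as [|p l Hp Hl IH]; simpl.
    - apply Clim_seq_const.
    - apply Clim_seq_plus; [|easy]. apply Clim_seq_mult; [apply Clim_seq_const|auto]. }
  assert (E' : forall m, in_span dom m ->
    Clim_seq (fun n => span_form (Kn n) l m) (span_form K l m)).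
  { intros m Hm. induction Hm as [|p m Hp Hm IH]; simpl.
    - apply Clim_seq_const.
    - apply Clim_seq_plus; [|easy]. apply Clim_seq_mult; [apply Clim_seq_const|auto]. }
  rewrite span_norm2_form. destruct (E' l Hl) as [L _].
  refine (is_lim_seq_le _ _ _ _ _ (is_lim_seq_const 0) L).
  intros n. rewrite <- span_norm2_form. now apply HP.
Qed.

End PositiveKernels.

(** * Inner products in [C^d] and positivity of [kf] *)

Lemma cinner_conj d z w : cinner d w z = Cconj (cinner d z w).
Proof.
  unfold cinner. induction d as [|d IH]; simpl; [apply C_ext; simpl; ring|].
  rewrite IH, Cplus_conj, Cmult_conj, Cconj_conj. ring.
Qed.

Lemma cinner_ext d z z' w w' : (forall i, (i < d)%nat -> z i = z' i) ->
  (forall i, (i < d)%nat -> w i = w' i) -> cinner d z w = cinner d z' w'.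
Proof.
  unfold cinner. induction d as [|d IH]; simpl; intros Hz Hw; [easy|].
  rewrite IH, Hz, Hw; auto.
Qed.

Lemma vnorm2_S d z : vnorm2 (S d) z = vnorm2 d z + Cmod (z d) ^ 2.
Proof. unfold vnorm2, cinner. rewrite Cmod_sqr. simpl. ring. Qed.

Lemma cinner_self d z : cinner d z z = RtoC (vnorm2 d z).
Proof.
  apply C_ext; [easy|]. pose proof (f_equal snd (cinner_conj d z z)) as E.
  simpl in *. lra.
Qed.

(** The arithmetic-geometric mean inequality in each coordinate. It is weaker than Cauchy-Schwarz
    but free of square roots, and sharp enough for vectors of norm at most 1. *)
Lemma Cmod_cinner_le d z w : Cmod (cinner d z w) <= (vnorm2 d z + vnorm2 d w) / 2.
Proof.
  induction d as [|d IH].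
  - unfold vnorm2, cinner. simpl. rewrite Cmod_0. lra.
  - rewrite !vnorm2_S. unfold cinner in *. simpl csum.
    eapply Rle_trans; [apply Cmod_triangle|]. rewrite Cmod_mult, Cmod_conj.
    pose proof (pow2_ge_0 (Cmod (z d) - Cmod (w d))). nra.
Qed.

Lemma Cconj_inv (z : C) : Cinv (Cconj z) = Cconj (Cinv z).
Proof.
  destruct z as [a b]. apply C_ext; simpl.
  - now replace (- b * (- b * 1)) with (b * (b * 1)) by ring.
  - replace (- b * (- b * 1)) with (b * (b * 1)) by ring. unfold Rdiv. ring.
Qed.

Lemma kf_hermitian d f : hermitian (kf d f).
Proof.
  intros z w. unfold kf. rewrite <- Cconj_inv. f_equal.
  rewrite Cminus_conj, <- cinner_conj. f_equal. apply C_ext; simpl; ring.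
Qed.

Lemma Clim_seq_geometric (c : C) : Cmod c < 1 -> Clim_seq (fun n => Cpow c n) (RtoC 0).
Proof.
  intros Hc.
  assert (L : is_lim_seq (fun n => Cmod (Cpow c n)) 0).
  { apply is_lim_seq_ext with (fun n => Cmod c ^ n).
    - intros n. now rewrite Cmod_pow.
    - apply is_lim_seq_geom. rewrite Rabs_pos_eq; [easy|apply Cmod_ge_0]. }
  split; apply is_lim_seq_abs_0;
    (refine (is_lim_seq_le_le _ _ _ _ _ (is_lim_seq_const 0) L); intros n;
     pose proof (Rmax_Cmod (Cpow c n)) as Q; split; [apply Rabs_pos|]).
  - eapply Rle_trans; [apply Rmax_l | exact Q].
  - eapply Rle_trans; [apply Rmax_r | exact Q].
Qed.

(** Partial sums of the geometric series of [kf], in Horner form: each step multiplies by the inner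
    product and adds the constant kernel 1, two operations that preserve positivity. *)
Fixpoint kf_partial (d : nat) (f : C -> nat -> C) (n : nat) (z w : C) : C :=
  match n with
  | O => RtoC 0
  | S n => Cplus (RtoC 1) (Cmult (cinner d (f z) (f w)) (kf_partial d f n z w))
  end.

Lemma one_minus_neq_0 (c : C) : Cmod c < 1 -> Cminus (RtoC 1) c <> RtoC 0.
Proof.
  intros Hc H. replace c with (RtoC 1) in Hc; [rewrite Cmod_1 in Hc; lra|].
  replace (RtoC 1) with (Cplus (Cminus (RtoC 1) c) c) by ring. rewrite H. ring.
Qed.

Lemma kf_partial_spec d f n z w : Cmod (cinner d (f z) (f w)) < 1 ->
  kf_partial d f n z w =
  Cplus (kf d f z w) (Cmult (Copp (kf d f z w)) (Cpow (cinner d (f z) (f w)) n)).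
Proof.
  intros H. pose proof (one_minus_neq_0 _ H) as H0. unfold kf.
  induction n as [|n IH]; simpl; [field; easy|]. rewrite IH. field. easy.
Qed.

Lemma kf_positive_semidefinite d f (dom : C -> Prop) :
  (forall z, dom z -> vnorm2 d (f z) < 1) -> positive_semidefinite dom (kf d f).
Proof.
  intros Hd. apply positive_semidefinite_lim with (Kn := kf_partial d f).
  - induction n as [|n IH]; [apply positive_semidefinite_zero|].
    apply (positive_semidefinite_plus dom (fun _ _ => RtoC 1)
      (fun z w => Cmult (cinner d (f z) (f w)) (kf_partial d f n z w)));
      [apply positive_semidefinite_one|].
    (* Only the number of coordinates in the outer factor is varied; the kernel [kf_partial] keeps
       the full dimension [d], so [IH] stays applicable. *)
    unfold cinner at 1. generalize d at 1 as d'.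
    induction d' as [|d' IHd]; simpl.
    + eapply positive_semidefinite_ext; [|apply positive_semidefinite_zero].
      intros z w. simpl. ring.
    + eapply positive_semidefinite_ext.
      2:{ apply positive_semidefinite_plus; [exact IHd|].
          apply positive_semidefinite_conj_mult with (g := fun z => f z d'). exact IH. }
      intros z w. simpl. ring.
  - intros z w Hz Hw.
    assert (Hc : Cmod (cinner d (f z) (f w)) < 1).
    { eapply Rle_lt_trans; [apply Cmod_cinner_le|].
      pose proof (Hd z Hz). pose proof (Hd w Hw). lra. }
    assert (L : Clim_seq (fun n => Cplus (kf d f z w)
        (Cmult (Copp (kf d f z w)) (Cpow (cinner d (f z) (f w)) n)))
      (Cplus (kf d f z w) (Cmult (Copp (kf d f z w)) (RtoC 0)))).
    { apply Clim_seq_plus; [apply Clim_seq_const|].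
      apply Clim_seq_mult; [apply Clim_seq_const|now apply Clim_seq_geometric]. }
    replace (Cplus (kf d f z w) (Cmult (Copp (kf d f z w)) (RtoC 0)))
      with (kf d f z w) in L by ring.
    destruct L as [L1 L2]. split.
    + eapply is_lim_seq_ext; [|exact L1]. intros n. now rewrite kf_partial_spec.
    + eapply is_lim_seq_ext; [|exact L2]. intros n. now rewrite kf_partial_spec.
Qed.

(** * Boundary derivatives: the Hopf lemma *)

Lemma is_derive_C_directional (G : C -> C) (z l v : C) : Cmod v = 1 ->
  is_derive (K := C_AbsRing) (V := C_NormedModule) G z l ->
  is_derive (fun t : R => fst (G (Cplus z (Cmult (RtoC t) v)))) 0 (fst (Cmult v l)) /\
  is_derive (fun t : R => snd (G (Cplus z (Cmult (RtoC t) v)))) 0 (snd (Cmult v l)).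
Proof.
  intros Hv [_ HG].
  specialize (HG z (fun P H => H)).
  assert (B : forall eps : posreal, exists delta : posreal, forall t : R, Rabs t < delta ->
    Cmod (Cminus (Cminus (G (Cplus z (Cmult (RtoC t) v))) (G z))
                 (Cmult (Cmult (RtoC t) v) l)) <= eps * Rabs t).
  { intros eps. destruct (HG eps) as [delta Hd]. exists delta. intros t Ht.
    specialize (Hd (Cplus z (Cmult (RtoC t) v))).
    assert (E : forall a b c : C, Cminus (Cplus a b) a = b) by (intros; ring).
    assert (Et : Cmod (Cmult (RtoC t) v) = Rabs t) by (rewrite Cmod_mult, Cmod_R, Hv; ring).
    assert (Hb : Cmod (Cminus (Cplus z (Cmult (RtoC t) v)) z) < delta).
    { rewrite E by exact z. now rewrite Et. }
    specialize (Hd Hb).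
    change (Cmod (Cminus (Cminus (G (Cplus z (Cmult (RtoC t) v))) (G z))
       (Cmult (Cminus (Cplus z (Cmult (RtoC t) v)) z) l)) <=
       eps * Cmod (Cminus (Cplus z (Cmult (RtoC t) v)) z)) in Hd.
    rewrite E in Hd by exact z. now rewrite Et in Hd. }
  assert (E0 : Cplus z (Cmult (RtoC 0) v) = z) by ring.
  (* Halving [eps] turns the non-strict remainder bound of the complex derivative into the strict
     one of the real derivative. *)
  assert (Q : forall (c : C) (eps : R), 0 < eps -> forall h, h <> 0 ->
     Cmod c <= eps / 2 * Rabs h -> Rabs (fst c / h) < eps /\ Rabs (snd c / h) < eps).
  { intros c eps He h Hh Hc. pose proof (Rmax_Cmod c) as M.
    assert (Ha : 0 < Rabs h) by now apply Rabs_pos_lt.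
    unfold Rdiv. rewrite !Rabs_mult, Rabs_inv.
    assert (forall a, a <= Cmod c -> a * / Rabs h < eps).
    { intros a Hac. apply Rmult_lt_reg_r with (Rabs h); [easy|].
      rewrite Rmult_assoc, Rinv_l by lra. nra. }
    split; apply H; (eapply Rle_trans; [|exact M]); [apply Rmax_l | apply Rmax_r]. }
  split; apply is_derive_Reals; intros eps He;
    destruct (B (mkposreal _ (is_pos_div_2 (mkposreal eps He)))) as [delta Hd];
    exists delta; intros h Hh0 Hh; specialize (Hd h Hh); simpl pos in Hd;
    destruct (Q _ _ He h Hh0 Hd) as [Q1 Q2]; rewrite Rplus_0_l, E0.
  - revert Q1. match goal with |- Rabs ?a < _ -> Rabs ?b < _ => replace a with b; [easy|] end.
    simpl. field. easy.
  - revert Q2. match goal with |- Rabs ?a < _ -> Rabs ?b < _ => replace a with b; [easy|] end.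
    simpl. field. easy.
Qed.

Lemma is_derive_shift (g : R -> R) (x l : R) :
  is_derive (fun t => g (x + t)) 0 l -> is_derive g x l.
Proof.
  intros H. apply is_derive_ext with (fun t => g (x + (t - x))).
  { intros t. f_equal. ring. }
  replace l with (1 * l) by ring.
  apply (is_derive_comp (fun s => g (x + s)) (fun t => t - x)).
  - replace (x - x) with 0 by ring. exact H.
  - auto_derive; [easy|ring].
Qed.

Lemma Cauchy_Riemann (G : C -> C) (x y : R) (l : C) :
  is_derive (K := C_AbsRing) (V := C_NormedModule) G (x, y) l ->
  is_derive (fun t : R => fst (G (t, y))) x (fst l) /\
  is_derive (fun t : R => snd (G (t, y))) x (snd l) /\
  is_derive (fun t : R => fst (G (x, t))) y (- snd l) /\
  is_derive (fun t : R => snd (G (x, t))) y (fst l).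
Proof.
  intros H.
  destruct (is_derive_C_directional G _ _ (RtoC 1) Cmod_1 H) as [A1 A2].
  assert (Hi : Cmod Ci = 1).
  { transitivity (sqrt 1); [unfold Cmod; simpl; f_equal; ring | apply sqrt_1]. }
  destruct (is_derive_C_directional G _ _ Ci Hi H) as [B1 B2].
  assert (E1 : forall t : R, Cplus (x, y) (Cmult (RtoC t) (RtoC 1)) = (x + t, y)).
  { intros t. apply C_ext; simpl; ring. }
  assert (E2 : forall t : R, Cplus (x, y) (Cmult (RtoC t) Ci) = (x, y + t)).
  { intros t. apply C_ext; simpl; ring. }
  refine (conj _ (conj _ (conj _ _))); apply is_derive_shift.
  - replace (fst l) with (fst (Cmult (RtoC 1) l)) by (simpl; ring).
    eapply is_derive_ext; [|exact A1].
    intros t. exact (f_equal (fun c => fst (G c)) (E1 t)).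
  - replace (snd l) with (snd (Cmult (RtoC 1) l)) by (simpl; ring).
    eapply is_derive_ext; [|exact A2].
    intros t. exact (f_equal (fun c => snd (G c)) (E1 t)).
  - replace (- snd l) with (fst (Cmult Ci l)) by (simpl; ring).
    eapply is_derive_ext; [|exact B1].
    intros t. exact (f_equal (fun c => fst (G c)) (E2 t)).
  - replace (fst l) with (snd (Cmult Ci l)) by (simpl; ring).
    eapply is_derive_ext; [|exact B2].
    intros t. exact (f_equal (fun c => snd (G c)) (E2 t)).
Qed.

(** * Local maxima in one variable and attained maxima in the plane *)

Lemma is_derive_local_max (g : R -> R) (x l : R) :
  is_derive g x l -> locally x (fun t => g t <= g x) -> l = 0.
Proof.
  intros H [delta Hd]. apply is_derive_Reals in H.
  assert (pr : derivable_pt g x) by now exists l.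
  pose proof (deriv_maximum g (x - delta) (x + delta) x pr) as E.
  assert (P := cond_pos delta).
  rewrite (derive_pt_eq_0 _ _ _ _ H) in E. apply E; try lra.
  intros t H1 H2. apply Hd. change (Rabs (t - x) < delta). apply Rabs_def1; lra.
Qed.

(** If [c > 0], then [g'], which vanishes at the maximum, is positive just to its right, and the
    mean value theorem makes [g] exceed its maximum there. *)
Lemma second_derivative_local_max (g g' : R -> R) (x c : R) :
  locally x (fun t => is_derive g t (g' t)) -> is_derive g' x c ->
  locally x (fun t => g t <= g x) -> c <= 0.
Proof.
  intros Hg Hg' Hm. apply Rnot_lt_le. intros Hc.
  assert (E : g' x = 0).
  { apply (is_derive_local_max g x); [|easy]. now apply locally_singleton in Hg. }
  destruct (filter_and _ _ Hg Hm) as [d1 H1].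
  apply is_derive_Reals in Hg'. destruct (Hg' (c / 2)) as [d2 H2]; [lra|].
  assert (P1 := cond_pos d1). assert (P2 := cond_pos d2).
  set (h := Rmin d1 d2 / 2).
  assert (Hh : 0 < h < d1 /\ h < d2).
  { unfold h. pose proof (Rmin_l d1 d2). pose proof (Rmin_r d1 d2).
    pose proof (Rmin_pos d1 d2 P1 P2). lra. }
  assert (N : forall t, x <= t <= x + h -> is_derive g t (g' t) /\ g t <= g x).
  { intros t Ht. apply H1. change (Rabs (t - x) < d1). apply Rabs_def1; lra. }
  destruct (MVT_cor2 g g' x (x + h)) as (t & Ht & Hxt); [lra| |].
  { intros t Ht. apply is_derive_Reals. now apply N. }
  assert (G : 0 < g' t).
  { specialize (H2 (t - x)). rewrite E in H2. replace (x + (t - x)) with t in H2 by ring.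
    assert (Ha : Rabs (t - x) < d2) by (apply Rabs_def1; lra).
    specialize (H2 ltac:(lra) Ha). apply Rabs_def2 in H2.
    assert (0 < (g' t - 0) / (t - x)) by lra.
    replace (g' t) with ((g' t - 0) / (t - x) * (t - x)) by (field; lra).
    apply Rmult_lt_0_compat; lra. }
  destruct (N (x + h)) as [_ Q]; [lra|]. nra.
Qed.

(** Compactness of the square in gauge form. One number is both the radius of validity and the
    parameter of [P], so a uniform radius is at once a uniform constant: below, [/ d] serves as an
    upper bound and [s - d] as a gap under the supremum. *)
Lemma gauge_uniform (a b : R) (P : R -> R -> R -> Prop) :
  (forall d e x y, 0 < d <= e -> P e x y -> P d x y) ->
  (forall u v, exists e : posreal, forall x y,
     Rabs (x - u) < e -> Rabs (y - v) < e -> P e x y) ->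
  exists d, 0 < d /\ forall x y, a <= x <= b -> a <= y <= b -> P d x y.
Proof.
  intros Hmon Hloc.
  set (delta := fun u v => proj1_sig (constructive_indefinite_description _ (Hloc u v))).
  destruct (compactness_value_2d a b a b delta) as [d Hd].
  exists d. split; [apply cond_pos|]. intros x y Hx Hy.
  (* [compactness_value_2d] provides the covering point only under a double negation. *)
  destruct (Classical_Prop.NNPP _ (Hd x y Hx Hy)) as (u & v & _ & _ & H1 & H2 & H3).
  apply Hmon with (delta u v); [split; [apply cond_pos|easy]|].
  exact (proj2_sig (constructive_indefinite_description _ (Hloc u v)) x y H1 H2).
Qed.

(** Two uses of [gauge_uniform]: the first bounds [w] on [S]; the second, if the supremum [s] were
    not attained, would give the smaller bound [s - e]. Near a point outside [S] both local
    conditions are vacuous, since [S] is closed. *)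
Lemma continuous_attains_max (a b : R) (S : R -> R -> Prop) (w : R -> R -> R) :
  (forall x y, S x y -> a <= x <= b /\ a <= y <= b) ->
  (exists x y, S x y) ->
  (forall x y, ~ S x y -> locally_2d (fun u v => ~ S u v) x y) ->
  (forall x y, S x y -> continuity_2d_pt w x y) ->
  exists x y, S x y /\ forall u v, S u v -> w u v <= w x y.
Proof.
  intros HS [x0 [y0 H0]] Hcl Hw.
  destruct (gauge_uniform a b (fun d x y => S x y -> w x y < / d)) as (d & Hd & Bd).
  { intros d e x y Hde H HSxy. eapply Rlt_le_trans; [now apply H|].
    apply Rinv_le_contravar; lra. }
  { intros u v. destruct (Classical_Prop.classic (S u v)) as [H|H].
    - destruct (Hw u v H (mkposreal 1 Rlt_0_1)) as [e He].
      assert (Pe := cond_pos e).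
      (* The second entry makes the inverse of the radius at least [|w u v| + 1], which dominates
         the nearby values of [w]. *)
      assert (Pm : 0 < Rmin e (/ (Rabs (w u v) + 1))).
      { apply Rmin_pos; [easy|]. apply Rinv_0_lt_compat.
        pose proof (Rabs_pos (w u v)). lra. }
      exists (mkposreal _ Pm). simpl. intros x y Hx Hy _.
      pose proof (Rmin_l e (/ (Rabs (w u v) + 1))).
      specialize (He x y ltac:(lra) ltac:(lra)). simpl in He.
      apply Rabs_def2 in He. pose proof (Rle_abs (w u v)).
      apply Rlt_le_trans with (Rabs (w u v) + 1); [lra|].
      apply Rle_trans with (/ / (Rabs (w u v) + 1)); [rewrite Rinv_inv; lra|].
      apply Rinv_le_contravar; [easy|apply Rmin_r].
    - destruct (Hcl u v H) as [e He]. exists e. intros x y Hx Hy Hn.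
      exfalso. now apply (He x y Hx Hy). }
  destruct (completeness (fun r => exists x y, S x y /\ r = w x y)) as [s [Hub Hlub]].
  { exists (/ d). intros r (x & y & HSxy & ->). left.
    destruct (HS x y HSxy). now apply Bd. }
  { now exists (w x0 y0), x0, y0. }
  apply Classical_Prop.NNPP. intros Hno.
  assert (Hlt : forall x y, S x y -> w x y < s).
  { intros x y HSxy. destruct (Hub (w x y)) as [H|H]; [now exists x, y|exact H|].
    exfalso. apply Hno. exists x, y. split; [easy|]. intros u v Huv.
    rewrite H. apply Hub. now exists u, v. }
  destruct (gauge_uniform a b (fun d x y => S x y -> w x y < s - d)) as (e & He & Be).
  { intros e e' x y Hee H HSxy. specialize (H HSxy). lra. }
  { intros u v. destruct (Classical_Prop.classic (S u v)) as [H|H].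
    - pose proof (Hlt u v H) as Hs.
      assert (Pg : 0 < (s - w u v) / 2) by lra.
      destruct (Hw u v H (mkposreal _ Pg)) as [e He].
      assert (Pe := cond_pos e).
      assert (Pm : 0 < Rmin e ((s - w u v) / 2)) by now apply Rmin_pos.
      exists (mkposreal _ Pm). simpl. intros x y Hx Hy _.
      pose proof (Rmin_l e ((s - w u v) / 2)). pose proof (Rmin_r e ((s - w u v) / 2)).
      specialize (He x y ltac:(lra) ltac:(lra)). simpl in He.
      apply Rabs_def2 in He. lra.
    - destruct (Hcl u v H) as [e He]. exists e. intros x y Hx Hy Hn.
      exfalso. now apply (He x y Hx Hy). }
  assert (s <= s - e); [|lra].
  apply Hlub. intros r (x & y & HSxy & ->). left.
  destruct (HS x y HSxy). now apply Be.
Qed.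

Lemma locally_2d_continuous_lt (w : R -> R -> R) (x y c : R) :
  continuity_2d_pt w x y -> w x y < c -> locally_2d (fun u v => w u v < c) x y.
Proof.
  intros Hw H. assert (P : 0 < c - w x y) by lra.
  destruct (Hw (mkposreal _ P)) as [d Hd]. exists d. intros u v Hu Hv.
  specialize (Hd u v Hu Hv). simpl in Hd. apply Rabs_def2 in Hd. lra.
Qed.

Lemma locally_2d_continuous_gt (w : R -> R -> R) (x y c : R) :
  continuity_2d_pt w x y -> c < w x y -> locally_2d (fun u v => c < w u v) x y.
Proof.
  intros Hw H. assert (P : 0 < w x y - c) by lra.
  destruct (Hw (mkposreal _ P)) as [d Hd]. exists d. intros u v Hu Hv.
  specialize (Hd u v Hu Hv). simpl in Hd. apply Rabs_def2 in Hd. lra.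
Qed.

Lemma norm2_continuous x y : continuity_2d_pt (fun u v => u ^ 2 + v ^ 2) x y.
Proof.
  apply continuity_2d_pt_ext with (fun u v => u * u + v * v); [intros; ring|].
  apply continuity_2d_pt_plus; apply continuity_2d_pt_mult;
    try apply continuity_2d_pt_id1; apply continuity_2d_pt_id2.
Qed.

Lemma annulus_closed (a b x y : R) : ~ (a <= x ^ 2 + y ^ 2 <= b) ->
  locally_2d (fun u v => ~ (a <= u ^ 2 + v ^ 2 <= b)) x y.
Proof.
  intros H. destruct (Rlt_dec (x ^ 2 + y ^ 2) a) as [H1|H1].
  - eapply locally_2d_impl; [|apply (locally_2d_continuous_lt _ _ _ _ (norm2_continuous x y) H1)].
    apply locally_2d_forall. intros u v Q. simpl in Q. lra.
  - assert (H2 : b < x ^ 2 + y ^ 2) by (apply Rnot_le_lt; intros Q; apply H; lra).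
    eapply locally_2d_impl; [|apply (locally_2d_continuous_gt _ _ _ _ (norm2_continuous x y) H2)].
    apply locally_2d_forall. intros u v Q. simpl in Q. lra.
Qed.

(** The body of [C2_on_R2] with the partial derivatives as parameters, so that several statements
    can refer to the same ones. *)
Definition C2_data (U : R -> R -> Prop) (g gx gy gxx gxy gyx gyy : R -> R -> R) : Prop :=
  forall x y, U x y ->
    is_derive (fun t => g t y) x (gx x y) /\ is_derive (fun t => g x t) y (gy x y) /\
    is_derive (fun t => gx t y) x (gxx x y) /\ is_derive (fun t => gx x t) y (gxy x y) /\
    is_derive (fun t => gy t y) x (gyx x y) /\ is_derive (fun t => gy x t) y (gyy x y) /\
    (forall h, In h [g; gx; gy; gxx; gxy; gyx; gyy] ->
       continuous (fun p : R * R => h (fst p) (snd p)) (x, y)).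

Definition open_2d (U : R -> R -> Prop) : Prop := forall x y, U x y -> locally_2d U x y.

Lemma C2_mixed_partials U g gx gy gxx gxy gyx gyy x y :
  open_2d U -> C2_data U g gx gy gxx gxy gyx gyy -> U x y -> gxy x y = gyx x y.
Proof.
  intros HU H Hxy.
  assert (D1 : forall u v, U u v -> Derive (fun t => g t v) u = gx u v).
  { intros u v Huv. apply is_derive_unique. now apply H. }
  assert (D2 : forall u v, U u v -> Derive (fun t => g u t) v = gy u v).
  { intros u v Huv. apply is_derive_unique. now apply H. }
  assert (E1 : forall u v, U u v ->
    is_derive (fun z => Derive (fun t => g z t) v) u (gyx u v)).
  { intros u v Huv. apply is_derive_ext_loc with (fun z => gy z v).
    - eapply filter_imp; [|apply (locally_2d_1d_const_y _ _ _ (HU u v Huv))].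
      intros z Hz. symmetry. now apply D2.
    - now apply H. }
  assert (E2 : forall u v, U u v ->
    is_derive (fun z => Derive (fun t => g t z) u) v (gxy u v)).
  { intros u v Huv. apply is_derive_ext_loc with (fun z => gx u z).
    - eapply filter_imp; [|apply (locally_2d_1d_const_x _ _ _ (HU u v Huv))].
      intros z Hz. symmetry. now apply D1.
    - now apply H. }
  rewrite <- (is_derive_unique _ _ _ (E1 x y Hxy)), <- (is_derive_unique _ _ _ (E2 x y Hxy)).
  symmetry. apply Schwarz.
  - eapply locally_2d_impl; [|apply (HU x y Hxy)]. apply locally_2d_forall.
    intros u v Huv. destruct (H u v Huv) as (h1 & h2 & _).
    refine (conj _ (conj _ (conj _ _))); eexists.
    + exact h1.
    + exact h2.
    + exact (E1 u v Huv).
    + exact (E2 u v Huv).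
  - apply continuity_2d_pt_ext_loc with gyx.
    + eapply locally_2d_impl; [|apply (HU x y Hxy)]. apply locally_2d_forall.
      intros u v Huv. symmetry. apply is_derive_unique. now apply E1.
    + apply continuity_2d_pt_filterlim. apply (H x y Hxy). simpl. tauto.
  - apply continuity_2d_pt_ext_loc with gxy.
    + eapply locally_2d_impl; [|apply (HU x y Hxy)]. apply locally_2d_forall.
      intros u v Huv. symmetry. apply is_derive_unique. now apply E2.
    + apply continuity_2d_pt_filterlim. apply (H x y Hxy). simpl. tauto.
Qed.

Lemma C2_differentiable U g gx gy gxx gxy gyx gyy x y :
  open_2d U -> C2_data U g gx gy gxx gxy gyx gyy -> U x y ->
  differentiable_pt_lim g x y (gx x y) (gy x y).
Proof.
  intros HU H Hxy. apply filterdiff_differentiable_pt_lim.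
  apply is_derive_filterdiff with (dfx := gx).
  - eapply filter_imp; [|apply (proj1 (locally_2d_locally _ _ _) (HU x y Hxy))].
    intros [u v] Huv. now apply H.
  - now apply H.
  - apply (H x y Hxy). simpl. tauto.
Qed.

Lemma disc_open : open_2d (fun x y => x ^ 2 + y ^ 2 < 1).
Proof. intros x y H. exact (locally_2d_continuous_lt _ x y 1 (norm2_continuous x y) H). Qed.

(** Differentiating the Cauchy-Riemann equations gives [uxx = vyx] and [uyy = - vxy], and mixed
    partials agree. The equations are known only on the open set [D], whose openness permits
    differentiating them. *)
Lemma Cauchy_Riemann_harmonic U u ux uy uxx uxy uyx uyy v vx vy vxx vxy vyx vyy D :
  open_2d U -> C2_data U u ux uy uxx uxy uyx uyy -> C2_data U v vx vy vxx vxy vyx vyy ->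
  open_2d D -> (forall x y, D x y -> U x y) ->
  (forall x y, D x y -> ux x y = vy x y /\ uy x y = - vx x y) ->
  forall x y, D x y -> uxx x y + uyy x y = 0.
Proof.
  intros HU Hu Hv HD DU CR x y Hxy. assert (Uxy := DU x y Hxy).
  assert (E1 : uxx x y = vyx x y).
  { rewrite <- (is_derive_unique (fun t => ux t y) x (uxx x y)) by now apply Hu.
    apply is_derive_unique. apply is_derive_ext_loc with (fun z => vy z y).
    - eapply filter_imp; [|apply (locally_2d_1d_const_y _ _ _ (HD x y Hxy))].
      intros z Hz. symmetry. now apply CR.
    - now apply Hv. }
  assert (E2 : uyy x y = - vxy x y).
  { rewrite <- (is_derive_unique (fun t => uy x t) y (uyy x y)) by now apply Hu.
    apply is_derive_unique. apply is_derive_ext_loc with (fun z => - vx x z).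
    - eapply filter_imp; [|apply (locally_2d_1d_const_x _ _ _ (HD x y Hxy))].
      intros z Hz. symmetry. now apply CR.
    - apply (is_derive_opp (fun z => vx x z)). now apply Hv. }
  rewrite E1, E2, (C2_mixed_partials U v vx vy vxx vxy vyx vyy) by easy. ring.
Qed.

(** With [s = 1 - (x^2 + y^2)] this is [s + 2 s^2]. The term [s] provides the nonzero normal slope
    at the circle; the term [2 s^2] lifts the Laplacian from [-4] to [32 (x^2 + y^2) - 20], which is
    at least 4 on the annulus starting at [3 / 4]. *)
Definition barrier (x y : R) : R := (1 - (x ^ 2 + y ^ 2)) + 2 * (1 - (x ^ 2 + y ^ 2)) ^ 2.

Lemma barrier_continuous x y : continuity_2d_pt barrier x y.
Proof.
  assert (C : continuity_2d_pt (fun u v => 1 - (u ^ 2 + v ^ 2)) x y).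
  { apply continuity_2d_pt_minus; [apply continuity_2d_pt_const|apply norm2_continuous]. }
  apply continuity_2d_pt_ext with (fun u v => (1 - (u ^ 2 + v ^ 2)) +
    2 * ((1 - (u ^ 2 + v ^ 2)) * (1 - (u ^ 2 + v ^ 2)))).
  { intros. unfold barrier. ring. }
  apply continuity_2d_pt_plus; [easy|].
  apply continuity_2d_pt_mult; [apply continuity_2d_pt_const|].
  now apply continuity_2d_pt_mult.
Qed.

(* Hopf's argument: [barrier] vanishes on the unit circle and is strictly subharmonic
   for [x^2 + y^2 > 5/8], so [g + e * barrier] has no interior maximum in the annulus. *)
Lemma Hopf_lemma U g gx gy gxx gxy gyx gyy :
  open_2d U -> C2_data U g gx gy gxx gxy gyx gyy ->
  (forall x y, x ^ 2 + y ^ 2 <= 1 -> U x y) ->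
  (forall x y, x ^ 2 + y ^ 2 < 1 -> gxx x y + gyy x y = 0) ->
  (forall x y, x ^ 2 + y ^ 2 < 1 -> g x y < 1) ->
  (forall x y, x ^ 2 + y ^ 2 <= 1 -> g x y <= 1) ->
  exists e, 0 < e /\ forall x y, 3 / 4 <= x ^ 2 + y ^ 2 <= 1 ->
    g x y <= 1 - e * (1 - (x ^ 2 + y ^ 2)).
Proof.
  intros HU H DU Hlap Hlt Hle.
  assert (Hc : forall x y, U x y -> continuity_2d_pt g x y).
  { intros x y Hxy. apply continuity_2d_pt_filterlim. apply (H x y Hxy). simpl. tauto. }
  assert (Hbox : forall a x y, a <= x ^ 2 + y ^ 2 <= 1 -> -1 <= x <= 1 /\ -1 <= y <= 1).
  { intros a x y [_ Q]. split; nra. }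
  assert (Hsq : sqrt (3 / 4) ^ 2 + 0 ^ 2 = 3 / 4) by (rewrite pow2_sqrt; lra).
  (* The inner circle is written as a degenerate annulus so that [annulus_closed] covers it too. *)
  destruct (continuous_attains_max (-1) 1 (fun x y => 3 / 4 <= x ^ 2 + y ^ 2 <= 3 / 4) g)
    as (x1 & y1 & H1 & M1).
  { intros x y Q. apply (Hbox (3 / 4)). lra. }
  { exists (sqrt (3 / 4)), 0. lra. }
  { intros x y. apply annulus_closed. }
  { intros x y Q. apply Hc, DU. lra. }
  pose proof (Hlt x1 y1 ltac:(lra)) as L1.
  (* The gap below 1 on the inner circle. There [barrier] equals [3 / 8], so [g + e * barrier] is at
     most [1 - e + 3 e / 8 < 1]; a value above 1 can thus occur on neither boundary circle. *)
  set (e := 1 - g x1 y1). exists e. split; [unfold e; lra|].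
  destruct (continuous_attains_max (-1) 1 (fun x y => 3 / 4 <= x ^ 2 + y ^ 2 <= 1)
    (fun x y => g x y + e * barrier x y)) as (x2 & y2 & H2 & M2).
  { intros x y Q. now apply (Hbox (3 / 4)). }
  { exists (sqrt (3 / 4)), 0. lra. }
  { intros x y. apply annulus_closed. }
  { intros x y Q. apply continuity_2d_pt_plus; [apply Hc, DU; lra|].
    apply continuity_2d_pt_mult; [apply continuity_2d_pt_const|apply barrier_continuous]. }
  assert (He : 0 < e) by (unfold e; lra).
  assert (W : g x2 y2 + e * barrier x2 y2 <= 1).
  { apply Rnot_lt_le. intros Hgt.
    assert (N1 : x2 ^ 2 + y2 ^ 2 < 1).
    { apply Rnot_le_lt. intros Q. assert (Q' : x2 ^ 2 + y2 ^ 2 = 1) by lra.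
      specialize (Hle x2 y2 ltac:(lra)). unfold barrier in Hgt. rewrite Q' in Hgt. lra. }
    assert (N2 : 3 / 4 < x2 ^ 2 + y2 ^ 2).
    { apply Rnot_le_lt. intros Q. assert (Q' : x2 ^ 2 + y2 ^ 2 = 3 / 4) by lra.
      specialize (M1 x2 y2 ltac:(lra)). unfold barrier in Hgt. rewrite Q' in Hgt.
      unfold e in *. lra. }
    assert (Loc : locally_2d (fun u v => 3 / 4 < u ^ 2 + v ^ 2 /\ u ^ 2 + v ^ 2 < 1) x2 y2).
    { apply locally_2d_and.
      - exact (locally_2d_continuous_gt _ _ _ _ (norm2_continuous x2 y2) N2).
      - exact (locally_2d_continuous_lt _ _ _ _ (norm2_continuous x2 y2) N1). }
    assert (U2 : U x2 y2) by (apply DU; lra).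
    assert (X : gxx x2 y2 + e * (-2 - 8 * (1 - (x2 ^ 2 + y2 ^ 2)) + 16 * x2 ^ 2) <= 0).
    { apply (second_derivative_local_max (fun t => g t y2 + e * barrier t y2)
        (fun t => gx t y2 + e * (-2 * t - 8 * t * (1 - (t ^ 2 + y2 ^ 2)))) x2).
      - eapply filter_imp; [|apply (locally_2d_1d_const_y _ _ _ Loc)].
        intros t Ht. simpl in Ht.
        apply (is_derive_plus (fun t => g t y2) (fun t => e * barrier t y2)).
        + apply H, DU. lra.
        + unfold barrier. auto_derive; [easy|ring].
      - apply (is_derive_plus (fun t => gx t y2)
          (fun t => e * (-2 * t - 8 * t * (1 - (t ^ 2 + y2 ^ 2))))).
        + now apply H.
        + auto_derive; [easy|ring].
      - eapply filter_imp; [|apply (locally_2d_1d_const_y _ _ _ Loc)].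
        intros t Ht. simpl in Ht. apply M2. lra. }
    assert (Y : gyy x2 y2 + e * (-2 - 8 * (1 - (x2 ^ 2 + y2 ^ 2)) + 16 * y2 ^ 2) <= 0).
    { apply (second_derivative_local_max (fun t => g x2 t + e * barrier x2 t)
        (fun t => gy x2 t + e * (-2 * t - 8 * t * (1 - (x2 ^ 2 + t ^ 2)))) y2).
      - eapply filter_imp; [|apply (locally_2d_1d_const_x _ _ _ Loc)].
        intros t Ht. simpl in Ht.
        apply (is_derive_plus (fun t => g x2 t) (fun t => e * barrier x2 t)).
        + apply H, DU. lra.
        + unfold barrier. auto_derive; [easy|ring].
      - apply (is_derive_plus (fun t => gy x2 t)
          (fun t => e * (-2 * t - 8 * t * (1 - (x2 ^ 2 + t ^ 2))))).
        + now apply H.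
        + auto_derive; [easy|ring].
      - eapply filter_imp; [|apply (locally_2d_1d_const_x _ _ _ Loc)].
        intros t Ht. simpl in Ht. apply M2. lra. }
    specialize (Hlap x2 y2 N1). nra. }
  intros x y Q. specialize (M2 x y Q). unfold barrier in M2 at 1.
  (* Dropping the square term of [barrier] leaves the linear decay that is claimed. *)
  pose proof (pow2_ge_0 (1 - (x ^ 2 + y ^ 2))). nra.
Qed.

(** * First derivatives at a point of the unit circle *)

Lemma Cmod_sqr_lt_1 (z : C) : Cmod z < 1 <-> fst z ^ 2 + snd z ^ 2 < 1.
Proof. rewrite <- Cmod_sqr. pose proof (Cmod_ge_0 z). split; nra. Qed.

Lemma Cmod_sqr_le_1 (z : C) : Cmod z <= 1 <-> fst z ^ 2 + snd z ^ 2 <= 1.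
Proof. rewrite <- Cmod_sqr. pose proof (Cmod_ge_0 z). split; nra. Qed.

Lemma eq_0_of_right_zero (e : R -> R) :
  continuous e 0 -> (forall s, 0 < s < 1 -> e s = 0) -> e 0 = 0.
Proof.
  intros Hc Hz. apply Classical_Prop.NNPP. intros Hn.
  assert (P : 0 < Rabs (e 0)) by now apply Rabs_pos_lt.
  destruct (Hc _ (locally_ball (e 0) (mkposreal _ P))) as [d Hd].
  assert (Pd := cond_pos d).
  assert (Ps : 0 < Rmin d 1 / 2 < 1 /\ Rmin d 1 / 2 < d).
  { pose proof (Rmin_l d 1). pose proof (Rmin_r d 1).
    pose proof (Rmin_pos d 1 Pd Rlt_0_1). lra. }
  specialize (Hd (Rmin d 1 / 2)).
  assert (B : ball 0 d (Rmin d 1 / 2)).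
  { change (Rabs (Rmin d 1 / 2 - 0) < d). apply Rabs_def1; lra. }
  specialize (Hd B). rewrite Hz in Hd by lra.
  change (Rabs (0 - e 0) < Rabs (e 0)) in Hd. rewrite Rminus_0_l, Rabs_Ropp in Hd. lra.
Qed.

Lemma continuous_radial (h : R -> R -> R) (x y : R) :
  continuous (fun p : R * R => h (fst p) (snd p)) (x, y) ->
  continuous (fun s => h ((1 - s) * x) ((1 - s) * y)) 0.
Proof.
  intros H. apply (continuous_comp_2 (fun s => (1 - s) * x) (fun s => (1 - s) * y) h).
  - apply (ex_derive_continuous (fun s => (1 - s) * x)). auto_derive. easy.
  - apply (ex_derive_continuous (fun s => (1 - s) * y)). auto_derive. easy.
  - replace ((1 - 0) * x) with x by ring. replace ((1 - 0) * y) with y by ring. exact H.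
Qed.

Lemma boundary_radial_derivative (U : C -> Prop) (G : C -> C) (xi : C) :
  open U -> (forall z, closed_disc z -> U z) ->
  C2_on_R2 (fun x y => U (x, y)) (fun x y => fst (G (x, y))) ->
  C2_on_R2 (fun x y => U (x, y)) (fun x y => snd (G (x, y))) ->
  (forall z, open_disc z -> ex_derive (K := C_AbsRing) (V := C_NormedModule) G z) ->
  (forall z, open_disc z -> fst (G z) < 1) ->
  (forall z, closed_disc z -> fst (G z) <= 1) ->
  unit_circle xi -> fst (G xi) = 1 ->
  exists A, 0 < A /\
    is_derive (fun s : R => fst (G (Cmult (RtoC (1 - s)) xi))) 0 (- A) /\
    is_derive (fun s : R => snd (G (Cmult (RtoC (1 - s)) xi))) 0 0.
Proof.
  intros HU DU (ux & uy & uxx & uxy & uyx & uyy & Hu)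
    (vx & vy & vxx & vxy & vyx & vyy & Hv) HG Hlt Hle Hxi G1.
  set (U' := fun x y => U (x, y)).
  assert (HU' : open_2d U').
  { intros x y Hxy. apply locally_2d_locally. eapply filter_imp; [|apply (HU (x, y) Hxy)].
    now intros []. }
  change (C2_data U' (fun x y => fst (G (x, y))) ux uy uxx uxy uyx uyy) in Hu.
  change (C2_data U' (fun x y => snd (G (x, y))) vx vy vxx vxy vyx vyy) in Hv.
  assert (DU' : forall x y, x ^ 2 + y ^ 2 <= 1 -> U' x y).
  { intros x y Q. apply DU. now apply Cmod_sqr_le_1. }
  assert (CR : forall x y, x ^ 2 + y ^ 2 < 1 -> ux x y = vy x y /\ uy x y = - vx x y).
  { intros x y Q. assert (Uxy : U' x y) by (apply DU'; lra).
    destruct (HG (x, y)) as [l Hl]; [now apply Cmod_sqr_lt_1|].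
    destruct (Cauchy_Riemann G x y l Hl) as (A1 & A2 & A3 & A4).
    destruct (Hu x y Uxy) as (B1 & B2 & _). destruct (Hv x y Uxy) as (B3 & B4 & _).
    apply is_derive_unique in A1, A2, A3, A4, B1, B2, B3, B4.
    split.
    - exact (eq_trans (eq_trans (eq_sym B1) A1) (eq_trans (eq_sym A4) B4)).
    - exact (eq_trans (eq_trans (eq_sym B2) A3) (f_equal Ropp (eq_trans (eq_sym A2) B3))). }
  destruct (Hopf_lemma U' _ _ _ _ _ _ _ HU' Hu DU') as (e & He & Hopf).
  { apply (Cauchy_Riemann_harmonic U' _ _ _ _ _ _ _ _ _ _ _ _ _ _ _ HU' Hu Hv disc_open).
    - intros x y Q. apply DU'. lra.
    - exact CR. }
  { intros x y Q. apply Hlt. now apply Cmod_sqr_lt_1. }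
  { intros x y Q. apply Hle. now apply Cmod_sqr_le_1. }
  destruct xi as [x0 y0].
  assert (N : x0 ^ 2 + y0 ^ 2 = 1).
  { pose proof (Cmod_sqr (x0, y0)) as Q. rewrite Hxi in Q. simpl in *. lra. }
  assert (U0 : U' x0 y0) by (apply DU'; lra).
  assert (Rad : forall s : R, Cmult (RtoC (1 - s)) (x0, y0) = ((1 - s) * x0, (1 - s) * y0)).
  { intros s. apply C_ext; simpl; ring. }
  assert (RadN : forall s : R, ((1 - s) * x0) ^ 2 + ((1 - s) * y0) ^ 2 = (1 - s) ^ 2).
  { intros s. transitivity ((1 - s) ^ 2 * (x0 ^ 2 + y0 ^ 2)); [ring|]. rewrite N. ring. }
  (* Complex differentiability gives the equations only inside the disc; they reach the boundary
     point along the radius by continuity of the first partials. *)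
  assert (CR0 : ux x0 y0 = vy x0 y0 /\ uy x0 y0 = - vx x0 y0).
  { destruct (Hu x0 y0 U0) as (_ & _ & _ & _ & _ & _ & Cu).
    destruct (Hv x0 y0 U0) as (_ & _ & _ & _ & _ & _ & Cv).
    assert (In1 : forall s, 0 < s < 1 -> ((1 - s) * x0) ^ 2 + ((1 - s) * y0) ^ 2 < 1).
    { intros s Hs. rewrite RadN. nra. }
    assert (E : forall h : R -> R -> R, h ((1 - 0) * x0) ((1 - 0) * y0) = h x0 y0).
    { intros h. f_equal; ring. }
    split.
    - rewrite <- (E ux), <- (E vy). apply Rminus_diag_uniq.
      apply (eq_0_of_right_zero
        (fun s => ux ((1 - s) * x0) ((1 - s) * y0) - vy ((1 - s) * x0) ((1 - s) * y0))).
      + apply (continuous_minus (V := R_NormedModule));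
          apply (continuous_radial _ x0 y0); [apply Cu|apply Cv]; simpl; tauto.
      + intros s Hs. destruct (CR _ _ (In1 s Hs)) as [-> _]. ring.
    - rewrite <- (E uy), <- (E vx). apply Rminus_diag_uniq.
      apply (eq_0_of_right_zero
        (fun s => uy ((1 - s) * x0) ((1 - s) * y0) - - vx ((1 - s) * x0) ((1 - s) * y0))).
      + apply (continuous_minus (V := R_NormedModule)).
        * apply (continuous_radial _ x0 y0); apply Cu; simpl; tauto.
        * apply (continuous_opp (V := R_NormedModule)).
          apply (continuous_radial _ x0 y0); apply Cv; simpl; tauto.
      + intros s Hs. destruct (CR _ _ (In1 s Hs)) as [_ ->]. ring. }
  destruct CR0 as [CR1 CR2].
  pose proof (C2_differentiable U' _ _ _ _ _ _ _ _ _ HU' Hu U0) as Du.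
  pose proof (C2_differentiable U' _ _ _ _ _ _ _ _ _ HU' Hv U0) as Dv.
  assert (Line : forall g lx ly, differentiable_pt_lim g x0 y0 lx ly ->
    is_derive (fun s => g ((1 - s) * x0) ((1 - s) * y0)) 0 (lx * - x0 + ly * - y0)).
  { intros g lx ly Hg. apply is_derive_Reals.
    apply (derivable_pt_lim_comp_2d g (fun s => (1 - s) * x0) (fun s => (1 - s) * y0)).
    - now replace ((1 - 0) * x0) with x0 by ring; replace ((1 - 0) * y0) with y0 by ring.
    - apply is_derive_Reals. auto_derive; [easy|ring].
    - apply is_derive_Reals. auto_derive; [easy|ring]. }
  (* the tangential derivative of [Re G] vanishes since [Re G] is maximal at [xi] *)
  assert (Tan : ux x0 y0 * - y0 + uy x0 y0 * x0 = 0).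
  { set (T := fun t => fst (G (x0 * cos t - y0 * sin t, y0 * cos t + x0 * sin t))).
    apply (is_derive_local_max T 0).
    - apply is_derive_Reals.
      apply (derivable_pt_lim_comp_2d (fun x y => fst (G (x, y)))
        (fun t => x0 * cos t - y0 * sin t) (fun t => y0 * cos t + x0 * sin t)).
      + rewrite cos_0, sin_0.
        now replace (x0 * 1 - y0 * 0) with x0 by ring;
          replace (y0 * 1 + x0 * 0) with y0 by ring.
      + apply is_derive_Reals. auto_derive; [easy|rewrite cos_0, sin_0; ring].
      + apply is_derive_Reals. auto_derive; [easy|rewrite cos_0, sin_0; ring].
    - apply filter_forall. intros t. unfold T. rewrite cos_0, sin_0.
      replace (x0 * 1 - y0 * 0, y0 * 1 + x0 * 0) with (x0, y0) by (f_equal; ring).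
      rewrite G1. apply Hle. apply Cmod_sqr_le_1. simpl fst; simpl snd.
      pose proof (sin2_cos2 t) as SC. unfold Rsqr in SC.
      replace ((x0 * cos t - y0 * sin t) ^ 2 + (y0 * cos t + x0 * sin t) ^ 2)
        with ((x0 ^ 2 + y0 ^ 2) * (sin t * sin t + cos t * cos t)) by ring.
      rewrite N, SC. lra. }
  exists (- (ux x0 y0 * - x0 + uy x0 y0 * - y0)). split; [|split].
  - pose proof (Line _ _ _ Du) as D. apply is_derive_Reals in D.
    set (L := ux x0 y0 * - x0 + uy x0 y0 * - y0) in *.
    apply Rnot_le_lt. intros HL.
    destruct (D (e / 2)) as [d Hd]; [lra|]. assert (Pd := cond_pos d).
    (* [s < d] makes the difference quotient exceed [- e / 2], while [s <= 1 / 16] keeps the point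
       in the annulus of [Hopf_lemma], which forces the quotient to be at most [- e]. *)
    set (s := Rmin d (1 / 8) / 2).
    assert (Hs : 0 < s < d /\ s <= 1 / 16).
    { unfold s. pose proof (Rmin_l d (1 / 8)). pose proof (Rmin_r d (1 / 8)).
      pose proof (Rmin_pos d (1 / 8) Pd ltac:(lra)). lra. }
    specialize (Hd s ltac:(lra) ltac:(apply Rabs_def1; lra)).
    specialize (Hopf ((1 - s) * x0) ((1 - s) * y0)). rewrite RadN in Hopf.
    rewrite Rplus_0_l in Hd.
    replace ((1 - 0) * x0) with x0 in Hd by ring. replace ((1 - 0) * y0) with y0 in Hd by ring.
    rewrite G1 in Hd. apply Rabs_def2 in Hd.
    assert (Q : (fst (G ((1 - s) * x0, (1 - s) * y0)) - 1) / s > - (e / 2)) by lra.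
    apply Rmult_gt_compat_r with (r := s) in Q; [|lra].
    unfold Rdiv in Q at 1. rewrite Rmult_assoc, Rinv_l, Rmult_1_r in Q by lra.
    assert (S1 : 3 / 4 <= (1 - s) ^ 2 <= 1) by (split; nra).
    specialize (Hopf S1).
    set (g := fst (G ((1 - s) * x0, (1 - s) * y0))) in *.
    assert (S2 : e * (1 - (1 - s) ^ 2) >= e * s).
    { apply Rle_ge, Rmult_le_compat_l; [lra|nra]. }
    nra.
  - rewrite Ropp_involutive.
    eapply is_derive_ext; [|exact (Line _ _ _ Du)]. intros s. simpl. now rewrite Rad.
  (* By the Cauchy-Riemann equations the inward radial derivative of [Im G] is the tangential
     derivative of [Re G], which is zero by [Tan]. *)
  - replace 0 with (vx x0 y0 * - x0 + vy x0 y0 * - y0) at 2 by (rewrite <- CR1; nra).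
    eapply is_derive_ext; [|exact (Line _ _ _ Dv)]. intros s. simpl. now rewrite Rad.
Qed.

(** * Kernel asymptotics at the self-intersection point *)

Lemma C2_on_R2_const U (c : R) : C2_on_R2 U (fun _ _ => c).
Proof.
  exists (fun _ _ => 0), (fun _ _ => 0), (fun _ _ => 0), (fun _ _ => 0),
    (fun _ _ => 0), (fun _ _ => 0).
  intros x y _.
  refine (conj _ (conj _ (conj _ (conj _ (conj _ (conj _ _))))));
    try apply (is_derive_const (K := R_AbsRing) (V := R_NormedModule)).
  intros h Hh. simpl in Hh. destruct Hh as [<-|[<-|[<-|[<-|[<-|[<-|[<-|[]]]]]]]];
    apply continuous_const.
Qed.

Lemma C2_on_R2_plus U (g h : R -> R -> R) :
  C2_on_R2 U g -> C2_on_R2 U h -> C2_on_R2 U (fun x y => g x y + h x y).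
Proof.
  intros (gx & gy & gxx & gxy & gyx & gyy & Hg) (hx & hy & hxx & hxy & hyx & hyy & Hh).
  exists (fun x y => gx x y + hx x y), (fun x y => gy x y + hy x y),
    (fun x y => gxx x y + hxx x y), (fun x y => gxy x y + hxy x y),
    (fun x y => gyx x y + hyx x y), (fun x y => gyy x y + hyy x y).
  intros x y Hxy.
  destruct (Hg x y Hxy) as (g1 & g2 & g3 & g4 & g5 & g6 & g7).
  destruct (Hh x y Hxy) as (h1 & h2 & h3 & h4 & h5 & h6 & h7).
  refine (conj _ (conj _ (conj _ (conj _ (conj _ (conj _ _))))));
    try (apply (is_derive_plus (K := R_AbsRing) (V := R_NormedModule)); assumption).
  intros k Hk. simpl in Hk. destruct Hk as [<-|[<-|[<-|[<-|[<-|[<-|[<-|[]]]]]]]];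
    (apply (continuous_plus (V := R_NormedModule)); [apply g7|apply h7]; simpl; tauto).
Qed.

Lemma C2_on_R2_scal U (g : R -> R -> R) (c : R) :
  C2_on_R2 U g -> C2_on_R2 U (fun x y => g x y * c).
Proof.
  intros (gx & gy & gxx & gxy & gyx & gyy & Hg).
  exists (fun x y => gx x y * c), (fun x y => gy x y * c),
    (fun x y => gxx x y * c), (fun x y => gxy x y * c),
    (fun x y => gyx x y * c), (fun x y => gyy x y * c).
  intros x y Hxy.
  destruct (Hg x y Hxy) as (g1 & g2 & g3 & g4 & g5 & g6 & g7).
  refine (conj _ (conj _ (conj _ (conj _ (conj _ (conj _ _))))));
    try (apply (is_derive_scal_l (K := R_AbsRing) (V := R_NormedModule)); assumption).
  intros k Hk. simpl in Hk. destruct Hk as [<-|[<-|[<-|[<-|[<-|[<-|[<-|[]]]]]]]];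
    (apply (continuous_mult (K := R_AbsRing)); [apply g7; simpl; tauto|apply continuous_const]).
Qed.

Lemma C2_on_R2_opp U (g : R -> R -> R) :
  C2_on_R2 U g -> C2_on_R2 U (fun x y => - g x y).
Proof.
  intros (gx & gy & gxx & gxy & gyx & gyy & Hg).
  exists (fun x y => - gx x y), (fun x y => - gy x y),
    (fun x y => - gxx x y), (fun x y => - gxy x y),
    (fun x y => - gyx x y), (fun x y => - gyy x y).
  intros x y Hxy.
  destruct (Hg x y Hxy) as (g1 & g2 & g3 & g4 & g5 & g6 & g7).
  refine (conj _ (conj _ (conj _ (conj _ (conj _ (conj _ _))))));
    try (apply (is_derive_opp (K := R_AbsRing) (V := R_NormedModule)); assumption).
  intros k Hk. simpl in Hk. destruct Hk as [<-|[<-|[<-|[<-|[<-|[<-|[<-|[]]]]]]]];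
    apply (continuous_opp (V := R_NormedModule)); apply g7; simpl; tauto.
Qed.

(** With [p] fixed, both parts of the inner product are real-linear combinations of the parts of the
    coordinates of [F], so the closure properties above suffice. *)
Lemma C2_cinner d U F p : C2_map_on d U F ->
  C2_on_R2 (fun x y => U (x, y)) (fun x y => fst (cinner d (F (x, y)) p)) /\
  C2_on_R2 (fun x y => U (x, y)) (fun x y => snd (cinner d (F (x, y)) p)).
Proof.
  unfold cinner. induction d as [|d IH]; intros HF.
  - split; exact (C2_on_R2_const _ 0).
  - destruct IH as [I1 I2]; [intros i Hi; apply HF; lia|].
    destruct (HF d ltac:(lia)) as [F1 F2].
    set (a := fst (Cconj (p d))). set (b := snd (Cconj (p d))).
    split.
    + exact (C2_on_R2_plus _ _ _ I1 (C2_on_R2_plus _ _ _ (C2_on_R2_scal _ _ a F1)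
        (C2_on_R2_opp _ _ (C2_on_R2_scal _ _ b F2)))).
    + exact (C2_on_R2_plus _ _ _ I2 (C2_on_R2_plus _ _ _ (C2_on_R2_scal _ _ b F1)
        (C2_on_R2_scal _ _ a F2))).
Qed.

Lemma C2_on_R2_radial_ex_derive (U : C -> Prop) (g : R -> R -> R) (xi : C) (c : R) :
  open U -> C2_on_R2 (fun x y => U (x, y)) g -> U xi ->
  ex_derive (fun s : R => g ((1 - s / c) * fst xi) ((1 - s / c) * snd xi)) 0.
Proof.
  intros HU (gx & gy & gxx & gxy & gyx & gyy & Hg) Hxi. destruct xi as [x0 y0].
  assert (HU' : open_2d (fun x y => U (x, y))).
  { intros x y Hxy. apply locally_2d_locally. eapply filter_imp; [|apply (HU (x, y) Hxy)].
    now intros []. }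
  pose proof (C2_differentiable _ _ _ _ _ _ _ _ x0 y0 HU' Hg Hxi) as D.
  simpl. exists (gx x0 y0 * (- / c * x0) + gy x0 y0 * (- / c * y0)).
  apply is_derive_Reals.
  apply (derivable_pt_lim_comp_2d g (fun s => (1 - s / c) * x0) (fun s => (1 - s / c) * y0)).
  - replace ((1 - 0 / c) * x0) with x0 by (unfold Rdiv; ring).
    replace ((1 - 0 / c) * y0) with y0 by (unfold Rdiv; ring). exact D.
  - apply is_derive_Reals. auto_derive; [easy|unfold Rdiv; ring].
  - apply is_derive_Reals. auto_derive; [easy|unfold Rdiv; ring].
Qed.

(** * First-order expansion of the inner product along two curves *)

Lemma is_derive_mult_vanish (a b : R -> R) :
  ex_derive a 0 -> ex_derive b 0 -> a 0 = 0 -> b 0 = 0 ->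
  is_derive (fun s => a s * b s) 0 0.
Proof.
  intros [a' Ha] [b' Hb] a0 b0.
  pose proof (is_derive_mult a b 0 a' b' Ha Hb (fun _ _ => Rmult_comm _ _)) as H.
  rewrite a0, b0 in H. change (is_derive (fun s => a s * b s) 0 (a' * 0 + 0 * b')) in H.
  now replace (a' * 0 + 0 * b') with 0 in H by ring.
Qed.

Definition curve_ex_derive (d : nat) (a : R -> nat -> C) : Prop := forall i, (i < d)%nat ->
  ex_derive (fun s => fst (a s i)) 0 /\ ex_derive (fun s => snd (a s i)) 0.

Lemma cinner_derive_vanish d (a b : R -> nat -> C) :
  curve_ex_derive d a -> curve_ex_derive d b ->
  (forall i, (i < d)%nat -> a 0 i = RtoC 0) -> (forall i, (i < d)%nat -> b 0 i = RtoC 0) ->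
  is_derive (fun s => fst (cinner d (a s) (b s))) 0 0 /\
  is_derive (fun s => snd (cinner d (a s) (b s))) 0 0.
Proof.
  unfold cinner, curve_ex_derive. induction d as [|d IH]; intros Ha Hb a0 b0.
  - split; exact (is_derive_const (K := R_AbsRing) (V := R_NormedModule) 0 0).
  - destruct (IH (fun i Hi => Ha i ltac:(lia)) (fun i Hi => Hb i ltac:(lia))
      (fun i Hi => a0 i ltac:(lia)) (fun i Hi => b0 i ltac:(lia))) as [I1 I2].
    destruct (Ha d ltac:(lia)) as [A1 A2]. destruct (Hb d ltac:(lia)) as [B1 B2].
    specialize (a0 d ltac:(lia)). specialize (b0 d ltac:(lia)).
    assert (B2' : ex_derive (fun s => - snd (b s d)) 0).
    { now apply (ex_derive_opp (fun s => snd (b s d))). }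
    assert (M : forall u v, ex_derive u 0 -> ex_derive v 0 -> u 0 = 0 -> v 0 = 0 ->
      is_derive (fun s => u s * v s) 0 0) by apply is_derive_mult_vanish.
    assert (P : forall u v : R -> R, is_derive u 0 0 -> is_derive v 0 0 ->
      is_derive (fun s => u s + v s) 0 0).
    { intros u v Hu Hv. replace 0 with (0 + 0) at 2 by ring.
      now apply (is_derive_plus (K := R_AbsRing) (V := R_NormedModule)). }
    assert (Q : forall u : R -> R, is_derive u 0 0 -> is_derive (fun s => - u s) 0 0).
    { intros u Hu. replace 0 with (- 0) at 2 by ring.
      now apply (is_derive_opp (K := R_AbsRing) (V := R_NormedModule)). }
    assert (z1 : fst (a 0 d) = 0) by now rewrite a0.
    assert (z2 : snd (a 0 d) = 0) by now rewrite a0.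
    assert (z3 : fst (b 0 d) = 0) by now rewrite b0.
    assert (z4 : - snd (b 0 d) = 0) by (rewrite b0; simpl; ring).
    split.
    + exact (P _ _ I1 (P _ _ (M _ _ A1 B1 z1 z3) (Q _ (M _ _ A2 B2' z2 z4)))).
    + exact (P _ _ I2 (P _ _ (M _ _ A1 B2' z1 z4) (M _ _ A2 B1 z2 z3))).
Qed.

(** Separates the pairings with [p], whose derivatives are controlled by the Hopf lemma, from a term
    quadratic in the displacements. The latter has derivative zero by [cinner_derive_vanish], so the
    tangent vectors themselves never need to be known. *)
Lemma cinner_expand d a b p :
  cinner d a b =
  Cplus (Cminus (Cplus (cinner d a p) (Cconj (cinner d b p))) (cinner d p p))
    (cinner d (fun i => Cminus (a i) (p i)) (fun i => Cminus (b i) (p i))).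
Proof.
  rewrite <- cinner_conj. unfold cinner. induction d as [|d IH]; simpl; [ring|].
  rewrite IH. rewrite Cminus_conj. ring.
Qed.

(** The normalised speed [-1] makes two branches through [p] with different tangent vectors
    indistinguishable, to first order, in their pairing with [p]. *)
Definition curve_at (d : nat) (p : nat -> C) (a : R -> nat -> C) : Prop :=
  curve_ex_derive d a /\ (forall i, (i < d)%nat -> a 0 i = p i) /\
  is_derive (fun s => fst (cinner d (a s) p)) 0 (-1) /\
  is_derive (fun s => snd (cinner d (a s) p)) 0 0.

Lemma cinner_curves_derive d p a b :
  curve_at d p a -> curve_at d p b ->
  is_derive (fun s => fst (cinner d (a s) (b s))) 0 (-2) /\
  is_derive (fun s => snd (cinner d (a s) (b s))) 0 0.
Proof.
  intros (Ha & a0 & A1 & A2) (Hb & b0 & B1 & B2).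
  assert (V : forall c, curve_ex_derive d c ->
    curve_ex_derive d (fun s i => Cminus (c s i) (p i))).
  { intros c Hc i Hi. destruct (Hc i Hi) as [C1 C2].
    split;
      [apply (ex_derive_minus (fun s => fst (c s i)) (fun _ => fst (p i)))
      |apply (ex_derive_minus (fun s => snd (c s i)) (fun _ => snd (p i)))];
      try assumption; apply ex_derive_const. }
  destruct (cinner_derive_vanish d _ _ (V a Ha) (V b Hb)) as [W1 W2].
  { intros i Hi. rewrite a0 by easy. ring. }
  { intros i Hi. rewrite b0 by easy. ring. }
  assert (P : forall (u v : R -> R) l m, is_derive u 0 l -> is_derive v 0 m ->
    is_derive (fun s => u s + v s) 0 (l + m)).
  { intros. now apply (is_derive_plus (K := R_AbsRing) (V := R_NormedModule)). }
  assert (Q : forall (u : R -> R) l, is_derive u 0 l -> is_derive (fun s => - u s) 0 (- l)).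
  { intros. now apply (is_derive_opp (K := R_AbsRing) (V := R_NormedModule)). }
  assert (Z : forall c : R, is_derive (fun _ : R => c) 0 0).
  { intros. apply (is_derive_const (K := R_AbsRing) (V := R_NormedModule)). }
  split.
  - eapply is_derive_ext.
    { intros s. symmetry. exact (f_equal fst (cinner_expand d (a s) (b s) p)). }
    replace (-2) with (-1 + -1 + - 0 + 0) by ring. simpl.
    exact (P _ _ _ _ (P _ _ _ _ (P _ _ _ _ A1 B1) (Q _ _ (Z (fst (cinner d p p))))) W1).
  - eapply is_derive_ext.
    { intros s. symmetry. exact (f_equal snd (cinner_expand d (a s) (b s) p)). }
    replace 0 with (0 + - 0 + - 0 + 0) at 2 by ring. simpl.
    exact (P _ _ _ _ (P _ _ _ _ (P _ _ _ _ A2 (Q _ _ B2)) (Q _ _ (Z (snd (cinner d p p))))) W2).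
Qed.

Lemma is_lim_seq_difference_quotient (g : R -> R) (l : R) (t : nat -> R) :
  is_derive g 0 l -> (forall n, 0 < t n) -> is_lim_seq t 0 ->
  is_lim_seq (fun n => (g (t n) - g 0) / t n) l.
Proof.
  intros Hg Ht Lt. apply is_derive_Reals in Hg. apply is_lim_seq_spec. intros eps.
  destruct (Hg eps (cond_pos eps)) as [d Hd].
  apply is_lim_seq_spec in Lt. destruct (Lt d) as [N HN]. exists N. intros n Hn.
  specialize (HN n Hn). rewrite Rminus_0_r in HN.
  specialize (Hd (t n)). rewrite Rplus_0_l in Hd. apply Hd; [|easy].
  specialize (Ht n). lra.
Qed.

Lemma kernel_lim d p a b (t : nat -> R) :
  curve_at d p a -> curve_at d p b -> cinner d p p = RtoC 1 ->
  (forall n, 0 < t n) -> is_lim_seq t 0 ->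
  (forall n, Cmod (cinner d (a (t n)) (b (t n))) < 1) ->
  is_lim_seq (fun n =>
    t n * fst (Cinv (Cminus (RtoC 1) (cinner d (a (t n)) (b (t n)))))) (1 / 2).
Proof.
  intros Ha Hb Hp Ht Lt Hc.
  destruct (cinner_curves_derive d p a b Ha Hb) as [D1 D2].
  pose proof (is_lim_seq_difference_quotient _ _ t D1 Ht Lt) as L1.
  pose proof (is_lim_seq_difference_quotient _ _ t D2 Ht Lt) as L2.
  destruct Ha as (_ & a0 & _). destruct Hb as (_ & b0 & _).
  simpl in L1, L2. rewrite (cinner_ext d (a 0) p (b 0) p a0 b0), Hp in L1, L2. simpl in L1, L2.
  set (X := fun n => (fst (cinner d (a (t n)) (b (t n))) - 1) / t n) in L1.
  set (Y := fun n => (snd (cinner d (a (t n)) (b (t n))) - 0) / t n) in L2.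
  (* Writing the inner product as [x + i y], one has [1 - x = - t X] and [y = t Y]; a factor [t^2]
     cancels in [t (1 - x) / ((1 - x)^2 + y^2)]. *)
  apply is_lim_seq_ext with (fun n => - X n / (X n * X n + Y n * Y n)).
  - intros n. unfold X, Y. specialize (Ht n). specialize (Hc n).
    (* Modulus below 1 forces [x < 1], so the denominators are nonzero for every [n]. *)
    pose proof (Re_le_Cmod (cinner d (a (t n)) (b (t n)))) as Q. simpl.
    destruct (cinner d (a (t n)) (b (t n))) as [x y]. simpl in *. field.
    split; [nra|lra].
  - replace (1 / 2) with (- -2 / (-2 * -2 + 0 * 0)) by field.
    apply is_lim_seq_div'.
    + apply (is_lim_seq_opp X (-2)). exact L1.
    + apply is_lim_seq_plus'; now apply is_lim_seq_mult'.
    + lra.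
Qed.

Lemma cinner_ex_derive d (F f : C -> nat -> C) (p : nat -> C) (z : C) :
  open_disc z -> (forall x, closed_disc x -> forall i, F x i = f x i) ->
  (forall i, (i < d)%nat ->
     ex_derive (K := C_AbsRing) (V := C_NormedModule) (fun w => f w i) z) ->
  ex_derive (K := C_AbsRing) (V := C_NormedModule) (fun w => cinner d (F w) p) z.
Proof.
  intros Hz HF Hf.
  apply ex_derive_ext_loc with (fun w => cinner d (f w) p).
  (* [F] and [f] agree only on the closed disc, but the ball of radius [1 - |z|] about [z] lies
     inside it. *)
  { assert (P : 0 < 1 - Cmod z) by (unfold open_disc in Hz; lra).
    exists (mkposreal _ P). intros w Hw.
    change (Cmod (Cminus w z) < 1 - Cmod z) in Hw.
    apply cinner_ext; [|easy]. intros i _. symmetry. apply HF. unfold closed_disc.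
    replace w with (Cplus (Cminus w z) z) by ring.
    eapply Rle_trans; [apply Cmod_triangle|]. lra. }
  unfold cinner. induction d as [|d IH]; simpl.
  - apply ex_derive_const.
  - apply (ex_derive_plus (K := C_AbsRing) (V := C_NormedModule)
      (fun w => csum d (fun i => Cmult (f w i) (Cconj (p i))))
      (fun w => Cmult (f w d) (Cconj (p d)))).
    + apply IH. intros i Hi. apply Hf. lia.
    + apply ex_derive_ext with (fun w => scal (K := C_AbsRing) (V := C_NormedModule)
        (Cconj (p d)) (f w d)).
      { intros w. apply Cmult_comm. }
      destruct (Hf d ltac:(lia)) as [l Hl]. exists (Cmult (Cconj (p d)) l).
      eapply filterdiff_ext_lin.
      { exact (filterdiff_scal_r_fct (K := C_AbsRing) (V := C_NormedModule) (Cconj (p d))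
          _ _ Cmult_comm Hl). }
      intros y. change (Cmult (Cconj (p d)) (Cmult y l) = Cmult y (Cmult (Cconj (p d)) l)). ring.
Qed.

(** * Radial curves ending at the self-intersection *)

Lemma Cmod_scal_circle (r : R) (xi : C) : unit_circle xi -> 0 <= r ->
  Cmod (Cmult (RtoC r) xi) = r.
Proof. intros H Hr. rewrite Cmod_mult, Cmod_R, H, Rabs_pos_eq by easy. ring. Qed.

(** The curve runs through the extension [F]: the derivatives in [curve_at] are two-sided, and for
    [s < 0] the argument leaves the closed disc. *)
Lemma boundary_curve d f U F xi :
  open U -> (forall x, closed_disc x -> U x) ->
  (forall x, closed_disc x -> forall i, F x i = f x i) -> C2_map_on d U F ->
  (forall z, open_disc z -> forall i, (i < d)%nat ->
      ex_derive (K := C_AbsRing) (V := C_NormedModule) (fun w => f w i) z) ->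
  (forall z, open_disc z -> ball_d d (f z)) ->
  (forall x, closed_disc x -> (vnorm2 d (f x) = 1 <-> Cmod x = 1)) ->
  unit_circle xi ->
  exists A, 0 < A /\ curve_at d (f xi) (fun s => F (Cmult (RtoC (1 - s / A)) xi)).
Proof.
  intros HU DU HFf HF Hhol Hball Hsph Hxi.
  assert (Cxi : closed_disc xi) by (unfold closed_disc; rewrite Hxi; lra).
  assert (Nxi : vnorm2 d (f xi) = 1) by now apply Hsph.
  destruct (C2_cinner d U F (f xi) HF) as [C1 C2].
  assert (B : forall z, closed_disc z ->
    fst (cinner d (F z) (f xi)) <= (vnorm2 d (f z) + 1) / 2).
  { intros z Hz. rewrite (cinner_ext d (F z) (f z) (f xi) (f xi)) by auto.
    rewrite <- Nxi. eapply Rle_trans; [apply Re_le_Cmod|apply Cmod_cinner_le]. }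
  destruct (boundary_radial_derivative U (fun z => cinner d (F z) (f xi)) xi)
    as (A & HA & D1 & D2); auto.
  { intros z Hz. apply cinner_ex_derive with f; auto. }
  { intros z Hz. destruct (Hball z Hz) as [_ Q].
    assert (Cz : closed_disc z) by (unfold open_disc, closed_disc in *; lra).
    specialize (B z Cz). lra. }
  { intros z Hz. specialize (B z Hz). destruct (Rle_lt_or_eq_dec _ _ Hz) as [Q|Q].
    - destruct (Hball z Q) as [_ Q']. lra.
    - apply Hsph in Q; [lra|easy]. }
  { rewrite (cinner_ext d (F xi) (f xi) (f xi) (f xi)) by auto. exact Nxi. }
  exists A. split; [easy|].
  (* Chain rule for [s / A]: it rescales the radial derivative [- A] to [-1] and keeps the imaginary
     one at zero. *)
  assert (R : forall (g : R -> R) l, is_derive g 0 l ->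
    is_derive (fun s => g (s / A)) 0 (/ A * l)).
  { intros g l Hg. apply (is_derive_comp g (fun s => s / A)).
    - now replace (0 / A) with 0 by (unfold Rdiv; ring).
    - auto_derive; [easy|unfold Rdiv; ring]. }
  refine (conj _ (conj _ (conj _ _))).
  - intros i Hi. destruct (HF i Hi) as [F1 F2].
    assert (E : forall s, Cmult (RtoC (1 - s / A)) xi =
      ((1 - s / A) * fst xi, (1 - s / A) * snd xi)).
    { intros s. destruct xi. apply C_ext; simpl; ring. }
    split.
    + eapply ex_derive_ext; [|exact (C2_on_R2_radial_ex_derive U _ xi A HU F1 (DU xi Cxi))].
      intros s. exact (f_equal (fun c => fst (F c i)) (eq_sym (E s))).
    + eapply ex_derive_ext; [|exact (C2_on_R2_radial_ex_derive U _ xi A HU F2 (DU xi Cxi))].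
      intros s. exact (f_equal (fun c => snd (F c i)) (eq_sym (E s))).
  - intros i Hi. replace (Cmult (RtoC (1 - 0 / A)) xi) with xi; [now apply HFf|].
    apply C_ext; simpl; field; lra.
  - replace (-1) with (/ A * - A) by (field; lra). exact (R _ _ D1).
  - replace 0 with (/ A * 0) at 2 by ring. exact (R _ _ D2).
Qed.

Lemma Clim_seq_radial (t : nat -> R) (A : R) (xi : C) : is_lim_seq t 0 ->
  Clim_seq (fun n => Cmult (RtoC (1 - t n / A)) xi) xi.
Proof.
  intros Ht.
  assert (L : Clim_seq (fun n => RtoC (1 - t n / A)) (RtoC 1)).
  { split; simpl; [|apply is_lim_seq_const].
    replace (Finite 1) with (Finite (1 - 0 * / A)) by (f_equal; ring).
    apply is_lim_seq_minus'; [apply is_lim_seq_const|].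
    apply is_lim_seq_mult'; [easy|apply is_lim_seq_const]. }
  pose proof (Clim_seq_mult _ _ _ _ L (Clim_seq_const xi)) as H.
  rewrite Cmult_1_l in H. exact H.
Qed.

(* The two radial speeds are normalised so that all three kernel values have the
   same leading term [1 / (2 t)]. *)
Lemma kernel_boundary_sequences d f xi zeta :
  embedding_map d f -> unit_circle xi -> unit_circle zeta -> (forall i, f xi i = f zeta i) ->
  exists (z w : nat -> C) (t : nat -> R),
    (forall n, open_disc (z n)) /\ (forall n, open_disc (w n)) /\ (forall n, 0 < t n) /\
    Clim_seq z xi /\ Clim_seq w zeta /\
    is_lim_seq (fun n => t n * fst (kf d f (z n) (z n))) (1 / 2) /\
    is_lim_seq (fun n => t n * fst (kf d f (w n) (w n))) (1 / 2) /\
    is_lim_seq (fun n => t n * fst (kf d f (z n) (w n))) (1 / 2).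
Proof.
  intros (_ & Hhol & _ & _ & Hball & (U & F & HU & DU & HFf & HF) & Hsph) Hxi Hzeta Heq.
  destruct (boundary_curve d f U F xi HU DU HFf HF Hhol Hball Hsph Hxi) as (A & HA & CA).
  destruct (boundary_curve d f U F zeta HU DU HFf HF Hhol Hball Hsph Hzeta) as (B & HB & CB).
  assert (Cxi : closed_disc xi) by (unfold closed_disc; rewrite Hxi; lra).
  assert (Hp : cinner d (f xi) (f xi) = RtoC 1).
  { rewrite cinner_self. f_equal. now apply Hsph. }
  (* The self-intersection enters here: the branch at [zeta] becomes a curve at the same base point
     [f xi]. *)
  assert (CB' : curve_at d (f xi) (fun s => F (Cmult (RtoC (1 - s / B)) zeta))).
  { destruct CB as (b1 & b2 & b3 & b4).
    assert (E : forall v, cinner d v (f zeta) = cinner d v (f xi)).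
    { intros v. apply cinner_ext; auto. }
    refine (conj b1 (conj _ (conj _ _))).
    - intros i Hi. rewrite Heq. now apply b2.
    - eapply is_derive_ext; [|exact b3]. intros s. simpl. now rewrite E.
    - eapply is_derive_ext; [|exact b4]. intros s. simpl. now rewrite E. }
  (* The minimum keeps both radii [1 - t / A] and [1 - t / B] in [[0, 1)] from the first index
     on. *)
  set (t := fun n : nat => Rmin A B * / (INR n + 1)).
  assert (Hm : 0 < Rmin A B) by now apply Rmin_pos.
  assert (Hn : forall n, 0 < / (INR n + 1) <= 1).
  { intros n. pose proof (pos_INR n). split; [apply Rinv_0_lt_compat; lra|].
    rewrite <- Rinv_1. apply Rinv_le_contravar; lra. }
  assert (Ht : forall n, 0 < t n).
  { intros n. destruct (Hn n). unfold t. now apply Rmult_lt_0_compat. }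
  assert (HtM : forall n, t n <= Rmin A B).
  { intros n. destruct (Hn n). unfold t. nra. }
  assert (Lt : is_lim_seq t 0).
  { replace 0 with (Rmin A B * 0) by ring.
    apply is_lim_seq_mult'; [apply is_lim_seq_const|].
    apply (is_lim_seq_inv (fun n => INR n + 1) p_infty); [|easy].
    apply is_lim_seq_ext with (fun n => INR (S n)); [intros n; apply S_INR|].
    apply (is_lim_seq_incr_1 INR p_infty). apply is_lim_seq_INR. }
  assert (Rad : forall A' n, 0 < A' -> Rmin A B <= A' -> 0 <= 1 - t n / A' < 1).
  { intros A' n P Q. specialize (Ht n). specialize (HtM n).
    assert (0 < t n / A') by now apply Rdiv_lt_0_compat.
    assert (t n / A' <= 1).
    { apply Rmult_le_reg_r with A'; [easy|]. unfold Rdiv.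
      rewrite Rmult_assoc, Rinv_l by lra. lra. }
    lra. }
  set (z := fun n => Cmult (RtoC (1 - t n / A)) xi).
  set (w := fun n => Cmult (RtoC (1 - t n / B)) zeta).
  assert (Hz : forall n, open_disc (z n)).
  { intros n. destruct (Rad A n HA (Rmin_l A B)).
    unfold open_disc, z. now rewrite Cmod_scal_circle. }
  assert (Hw : forall n, open_disc (w n)).
  { intros n. destruct (Rad B n HB (Rmin_r A B)).
    unfold open_disc, w. now rewrite Cmod_scal_circle. }
  assert (Inn : forall u v, open_disc u -> open_disc v ->
    cinner d (F u) (F v) = cinner d (f u) (f v) /\ Cmod (cinner d (F u) (F v)) < 1).
  { intros u v Hu Hv.
    assert (E : cinner d (F u) (F v) = cinner d (f u) (f v)).
    { apply cinner_ext; intros i _; apply HFf; unfold open_disc, closed_disc in *; lra. }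
    split; [easy|]. rewrite E. eapply Rle_lt_trans; [apply Cmod_cinner_le|].
    destruct (Hball u Hu), (Hball v Hv). lra. }
  exists z, w, t. refine (conj Hz (conj Hw (conj Ht (conj _ (conj _ (conj _ (conj _ _))))))).
  - now apply Clim_seq_radial.
  - now apply Clim_seq_radial.
  - eapply is_lim_seq_ext; [|apply (kernel_lim d (f xi) _ _ t CA CA Hp Ht Lt)].
    + intros n. unfold kf. simpl. fold (z n). destruct (Inn (z n) (z n)) as [-> _]; auto.
    + intros n. simpl. fold (z n). apply Inn; auto.
  - eapply is_lim_seq_ext; [|apply (kernel_lim d (f xi) _ _ t CB' CB' Hp Ht Lt)].
    + intros n. unfold kf. simpl. fold (w n). destruct (Inn (w n) (w n)) as [-> _]; auto.
    + intros n. simpl. fold (w n). apply Inn; auto.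
  - eapply is_lim_seq_ext; [|apply (kernel_lim d (f xi) _ _ t CA CB' Hp Ht Lt)].
    + intros n. unfold kf. simpl. fold (z n). fold (w n).
      destruct (Inn (z n) (w n)) as [-> _]; auto.
    + intros n. simpl. fold (z n). fold (w n). apply Inn; auto.
Qed.

(** * Multipliers cannot oscillate between close kernels *)

Section Oscillation.
Context {X : Type} (dom : X -> Prop) (K : X -> X -> C).
Context (K_herm : hermitian K) (K_psd : positive_semidefinite dom K).

Lemma span_form_nil_l (m : list (C * X)) : span_form K [] m = RtoC 0.
Proof. induction m as [|p m IH]; simpl; [easy|]. rewrite IH. ring. Qed.

Lemma span_norm2_scale c (l : list (C * X)) :
  span_norm2 K (span_scale c l) = Cmod c ^ 2 * span_norm2 K l.
Proof.
  pose proof (span_norm2_add_scale K [] l c K_herm) as E. simpl app in E.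
  rewrite E, span_form_nil_l. unfold span_norm2 at 1. simpl. ring.
Qed.

Lemma span_eval_bound l z : in_span dom l -> dom z ->
  Cmod (span_eval K l z) ^ 2 <= span_norm2 K l * fst (K z z).
Proof.
  intros Hl Hz.
  assert (Hs : in_span dom [(RtoC 1, z)]) by (repeat constructor; easy).
  pose proof (span_Cauchy_Schwarz dom K l _ K_herm K_psd Hl Hs) as H.
  replace (span_form K l [(RtoC 1, z)]) with (span_eval K l z) in H.
  2:{ simpl. apply C_ext; simpl; ring. }
  replace (span_norm2 K [(RtoC 1, z)]) with (fst (K z z)) in H; [easy|].
  unfold span_norm2. simpl. ring.
Qed.

Lemma kernel_diag_nonneg z : dom z -> 0 <= fst (K z z).
Proof.
  intros Hz. assert (Hs : in_span dom [(RtoC 1, z)]) by (repeat constructor; easy).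
  pose proof (K_psd _ Hs) as H. unfold span_norm2 in H. simpl in H. lra.
Qed.

(** [in_RKHS] has completeness built in, so only pointwise convergence has to be shown; it follows
    because evaluation at [z] is bounded by the norm times the root of [K z z]. *)
Lemma span_Cauchy_limit (g : nat -> list (C * X)) :
  (forall n, in_span dom (g n)) ->
  (forall eps, 0 < eps -> exists N, forall n m, (N <= n)%nat -> (N <= m)%nat ->
     span_norm2 K (span_sub (g n) (g m)) < eps) ->
  exists h, in_RKHS dom K h /\
    forall z, dom z -> Clim_seq (fun n => span_eval K (g n) z) (h z).
Proof.
  intros Hg Hc.
  assert (L : forall z, dom z ->
    ex_finite_lim_seq (fun n => fst (span_eval K (g n) z)) /\
    ex_finite_lim_seq (fun n => snd (span_eval K (g n) z))).
  { intros z Hz. pose proof (kernel_diag_nonneg z Hz) as Pz.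
    assert (B : forall eps : posreal, exists N, forall n m, (N <= n)%nat -> (N <= m)%nat ->
      Cmod (Cminus (span_eval K (g n) z) (span_eval K (g m) z)) < eps).
    { intros eps. assert (Pe := cond_pos eps).
      (* Adding 1 keeps the denominator positive when [K z z] vanishes. *)
      assert (P : 0 < eps ^ 2 / (fst (K z z) + 1)).
      { apply Rdiv_lt_0_compat; [|lra]. now apply pow_lt. }
      destruct (Hc _ P) as [N HN]. exists N. intros n m Hn Hm.
      specialize (HN n m Hn Hm). rewrite <- span_eval_sub.
      assert (Hs : in_span dom (span_sub (g n) (g m))).
      { rewrite span_sub_scale. apply in_span_app; [|apply in_span_scale]; apply Hg. }
      pose proof (span_eval_bound _ z Hs Hz) as Q.
      apply Rnot_le_lt. intros Hge.
      assert (Q1 : eps ^ 2 <= Cmod (span_eval K (span_sub (g n) (g m)) z) ^ 2).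
      { apply pow_incr. lra. }
      apply Rmult_lt_compat_r with (r := fst (K z z) + 1) in HN; [|lra].
      unfold Rdiv in HN. rewrite Rmult_assoc, Rinv_l, Rmult_1_r in HN by lra.
      pose proof (K_psd _ Hs). nra. }
    split; apply ex_lim_seq_cauchy_corr; intros eps; destruct (B eps) as [N HN];
      exists N; intros n m Hn Hm; specialize (HN n m Hn Hm);
      (eapply Rle_lt_trans; [|exact HN]);
      pose proof (Rmax_Cmod (Cminus (span_eval K (g n) z) (span_eval K (g m) z))) as M;
      (eapply Rle_trans; [|exact M]).
    - apply (Rmax_l (Rabs (fst (Cminus (span_eval K (g n) z) (span_eval K (g m) z))))).
    - apply (Rmax_r _ (Rabs (snd (Cminus (span_eval K (g n) z) (span_eval K (g m) z))))). }
  (* Outside [dom] the value is whatever [Lim_seq] returns; membership in the space concerns [dom]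
     alone. *)
  set (h := fun z => (real (Lim_seq (fun n => fst (span_eval K (g n) z))),
                      real (Lim_seq (fun n => snd (span_eval K (g n) z)))) : C).
  assert (Hh : forall z, dom z -> Clim_seq (fun n => span_eval K (g n) z) (h z)).
  { intros z Hz. destruct (L z Hz) as [L1 L2].
    split; simpl; now apply Lim_seq_correct'. }
  exists h. split; [|easy]. exists g. split; [exact Hg|]. split; [exact Hc|].
  intros z Hz. apply Clim_seq_filterlim. now apply Hh.
Qed.

Context (K_Re : forall z w, dom z -> dom w -> 0 <= fst (K z w)).

(** Indexed by start and length so that the difference of two partial sums is, up to sign, again a
    segment. *)
Fixpoint segment (c : nat -> R) (z : nat -> X) (m k : nat) : list (C * X) :=
  match k with
  | O => []
  | S k => segment c z m k ++ [(RtoC (c (m + k)%nat), z (m + k)%nat)]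
  end.

Lemma segment_in_span c z m k : (forall n, dom (z n)) -> in_span dom (segment c z m k).
Proof.
  intros Hz. induction k as [|k IH]; simpl; [constructor|].
  apply in_span_app; [easy|]. repeat constructor. apply Hz.
Qed.

Lemma segment_eval_split c z m k x :
  span_eval K (segment c z 0 (m + k)) x =
  Cplus (span_eval K (segment c z 0 m) x) (span_eval K (segment c z m k) x).
Proof.
  induction k as [|k IH].
  - rewrite Nat.add_0_r. simpl. ring.
  - rewrite Nat.add_succ_r. simpl. rewrite !span_eval_app, IH. simpl. ring.
Qed.

(** The triangle inequality in squared form: the [n]-th term has norm at most [(1 / 2) ^ n], and the
    right-hand side is the square of the finite geometric sum. The cross term is handled by
    Cauchy-Schwarz. *)
Lemma segment_norm2 c z m k : (forall n, dom (z n)) ->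
  (forall n, c n ^ 2 * fst (K (z n) (z n)) <= ((1 / 2) ^ n) ^ 2) ->
  span_norm2 K (segment c z m k) <= (2 * (1 / 2) ^ m - 2 * (1 / 2) ^ (m + k)) ^ 2.
Proof.
  intros Hz Hc. induction k as [|k IH].
  - rewrite Nat.add_0_r. unfold span_norm2. simpl. lra.
  - cbn [segment]. set (l := segment c z m k) in *. set (j := (m + k)%nat) in *.
    assert (Hl : in_span dom l) by now apply segment_in_span.
    assert (Hp : in_span dom [(RtoC (c j), z j)]) by (repeat constructor; apply Hz).
    replace [(RtoC (c j), z j)] with (span_scale (RtoC 1) [(RtoC (c j), z j)])
      by (simpl; do 2 f_equal; ring).
    rewrite span_norm2_add_scale by easy.
    pose proof (span_Cauchy_Schwarz dom K l _ K_herm K_psd Hl Hp) as CS.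
    set (B := span_form K l [(RtoC (c j), z j)]) in *.
    assert (Np : span_norm2 K [(RtoC (c j), z j)] <= ((1 / 2) ^ j) ^ 2).
    { eapply Rle_trans; [|apply (Hc j)]. right. unfold span_norm2. simpl. ring. }
    pose proof (K_psd _ Hp) as Pp. pose proof (K_psd _ Hl) as Pl.
    set (s := 2 * (1 / 2) ^ m - 2 * (1 / 2) ^ j) in *.
    assert (Hs : 0 <= s).
    { unfold s, j. rewrite pow_add.
      assert (0 < (1 / 2) ^ m) by (apply pow_lt; lra).
      assert ((1 / 2) ^ k <= 1 ^ k) by (apply pow_incr; lra). rewrite pow1 in H0. nra. }
    assert (Ha : 0 < (1 / 2) ^ j) by (apply pow_lt; lra).
    replace (2 * (1 / 2) ^ m - 2 * (1 / 2) ^ (m + S k)) with (s + (1 / 2) ^ j).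
    2:{ unfold s, j. rewrite Nat.add_succ_r. simpl. field. }
    set (a := (1 / 2) ^ j) in *.
    assert (HB : fst B <= s * a).
    { eapply Rle_trans; [apply Re_le_Cmod|]. apply Rle_of_sqr_le; [nra|].
      eapply Rle_trans; [exact CS|].
      replace ((s * a) ^ 2) with (s ^ 2 * a ^ 2) by ring.
      now apply Rmult_le_compat. }
    rewrite Cmod_1. replace (fst (Cmult (Cconj (RtoC 1)) B)) with (fst B) by (simpl; ring).
    nra.
Qed.

Lemma segment_Re_lower c z j n : (forall n, dom (z n)) -> (forall n, 0 <= c n) ->
  (j < n)%nat -> c j * fst (K (z j) (z j)) <= fst (span_eval K (segment c z 0 n) (z j)).
Proof.
  intros Hz Hc Hj.
  assert (E : forall n, fst (span_eval K (segment c z 0 (S n)) (z j)) =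
    fst (span_eval K (segment c z 0 n) (z j)) + c n * fst (K (z j) (z n))).
  { intros k. cbn [segment]. rewrite span_eval_app. simpl. ring. }
  assert (P : forall n, 0 <= c n * fst (K (z j) (z n))).
  { intros k. apply Rmult_le_pos; [apply Hc|now apply K_Re]. }
  assert (N : forall n, 0 <= fst (span_eval K (segment c z 0 n) (z j))).
  { induction n0 as [|k IH]; [simpl; lra|]. rewrite E. specialize (P k). lra. }
  induction Hj as [|n Hj IH]; rewrite E.
  - specialize (N j). lra.
  - specialize (P n). lra.
Qed.

(* The test function is [h = sum_j 2^-j sqrt(t_j) K(., z_j)]: since [Re K >= 0], no
   cancellation occurs and [Re h(z_j)] is at least its [j]-th term. *)
Lemma multiplier_no_fast_oscillation (phi : X -> C) (z w : nat -> X) (t : nat -> R) (M e : R) :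
  multiplier dom K phi ->
  (forall j, dom (z j)) -> (forall j, dom (w j)) -> (forall j, 0 < t j) ->
  (forall j, 1 / 4 <= t j * fst (K (z j) (z j)) <= 1) ->
  (forall j, t j * (fst (K (z j) (z j)) + fst (K (w j) (w j)) - 2 * fst (K (z j) (w j)))
     <= (1 / 16) ^ j) ->
  (forall j, Cmod (phi (w j)) ^ 2 <= M) -> 0 < e ->
  ~ (forall j, e <= Cmod (Cminus (phi (z j)) (phi (w j))) ^ 2).
Proof.
  intros Hphi Hz Hw Ht Hd Hq HM He Hosc.
  set (c := fun j => (1 / 2) ^ j * sqrt (t j)).
  assert (Hc0 : forall j, 0 <= c j).
  { intros j. apply Rmult_le_pos; [apply pow_le; lra|apply sqrt_pos]. }
  assert (Hc : forall n, c n ^ 2 * fst (K (z n) (z n)) <= ((1 / 2) ^ n) ^ 2).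
  { intros n. unfold c. rewrite Rpow_mult_distr, pow2_sqrt by (left; apply Ht).
    pose proof (pow2_ge_0 ((1 / 2) ^ n)). specialize (Hd n). nra. }
  assert (Hpow : forall n, 0 < (1 / 2) ^ n) by (intros; apply pow_lt; lra).
  assert (Hseg : forall m k, span_norm2 K (segment c z m k) <= 4 * (1 / 2) ^ m).
  { intros m k. eapply Rle_trans; [now apply segment_norm2|].
    rewrite pow_add. pose proof (Hpow m). pose proof (Hpow k).
    assert (Q : forall i, (1 / 2) ^ i <= 1).
    { intros i. apply Rle_trans with (1 ^ i); [apply pow_incr; lra|rewrite pow1; lra]. }
    pose proof (Q m). pose proof (Q k).
    replace ((2 * (1 / 2) ^ m - 2 * ((1 / 2) ^ m * (1 / 2) ^ k)) ^ 2)
      with (4 * (1 / 2) ^ m * ((1 / 2) ^ m * (1 - (1 / 2) ^ k) ^ 2)) by ring.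
    assert ((1 - (1 / 2) ^ k) ^ 2 <= 1) by nra.
    assert ((1 / 2) ^ m * (1 - (1 / 2) ^ k) ^ 2 <= 1).
    { apply Rle_trans with (1 * 1); [|lra].
      apply Rmult_le_compat; try lra. apply pow2_ge_0. }
    nra. }
  destruct (span_Cauchy_limit (fun n => segment c z 0 n)) as (h & Hh & Lh).
  { intros n. now apply segment_in_span. }
  { intros eps Heps.
    destruct (pow_lt_1_zero (1 / 2)) with (y := eps / 4) as [N HN].
    { rewrite Rabs_pos_eq; lra. } { lra. }
    assert (Small : forall m k, (N <= m)%nat -> span_norm2 K (segment c z m k) < eps).
    { intros m k Hm. specialize (HN m Hm). specialize (Hseg m k).
      rewrite Rabs_pos_eq in HN by (left; apply Hpow). lra. }
    exists N. intros n m Hn Hm. destruct (Nat.le_ge_cases m n) as [Q|Q].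
    - replace n with (m + (n - m))%nat by lia. set (k := (n - m)%nat).
      rewrite (span_norm2_ext K _ (segment c z m k) K_herm); [now apply Small|].
      intros x. rewrite span_eval_sub, segment_eval_split. ring.
    - replace m with (n + (m - n))%nat by lia. set (k := (m - n)%nat).
      rewrite (span_norm2_ext K _ (span_scale (Copp (RtoC 1)) (segment c z n k)) K_herm).
      + rewrite span_norm2_scale, Cmod_opp, Cmod_1. specialize (Small n k Hn). lra.
      + intros x. rewrite span_eval_sub, segment_eval_split, span_eval_scale. ring. }
  assert (Hlow : forall j, c j * fst (K (z j) (z j)) <= fst (h (z j))).
  { intros j. destruct (Lh (z j) (Hz j)) as [L _].
    refine (is_lim_seq_le_loc _ _ _ _ _ (is_lim_seq_const _) L).
    exists (S j). intros n Hn. now apply segment_Re_lower. }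
  (* A single [h] serves every [j], so [M1] and [M2] are independent of [j]; this uniformity stands
     in for an operator norm. *)
  destruct (RKHS_difference_bound dom K h K_herm K_psd Hh) as (M1 & P1 & B1).
  destruct (RKHS_difference_bound dom K _ K_herm K_psd (Hphi h Hh)) as (M2 & P2 & B2).
  set (M3 := 2 * M2 + 2 * M * M1).
  (* The estimates combine to [e 4^-j / 16 <= e t |h(z)|^2 <= M3 t Q <= M3 16^-j]; dividing by
     [4^-j] leaves a bound that tends to zero. [M3] comes from splitting [(phi(z) - phi(w)) h(z)] as
     [(phi(z) h(z) - phi(w) h(w)) - phi(w) (h(z) - h(w))]. *)
  assert (Main : forall j, e / 16 <= M3 * (1 / 4) ^ j).
  { intros j. specialize (B1 _ _ (Hz j) (Hw j)). specialize (B2 _ _ (Hz j) (Hw j)).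
    specialize (Hosc j). specialize (HM j). specialize (Hq j). specialize (Hlow j).
    specialize (Hd j). specialize (Ht j). cbv beta in B2.
    set (Q := fst (K (z j) (z j)) + fst (K (w j) (w j)) - 2 * fst (K (z j) (w j))) in *.
    pose proof (Cmod_plus_sqr_le
      (Cminus (Cmult (phi (z j)) (h (z j))) (Cmult (phi (w j)) (h (w j))))
      (Cmult (Copp (phi (w j))) (Cminus (h (z j)) (h (w j))))) as T.
    replace (Cplus (Cminus (Cmult (phi (z j)) (h (z j))) (Cmult (phi (w j)) (h (w j))))
        (Cmult (Copp (phi (w j))) (Cminus (h (z j)) (h (w j)))))
      with (Cmult (Cminus (phi (z j)) (phi (w j))) (h (z j))) in T by ring.
    rewrite !Cmod_mult, !Rpow_mult_distr, Cmod_opp in T.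
    assert (U : e * Cmod (h (z j)) ^ 2 <= M3 * Q).
    { pose proof (pow2_ge_0 (Cmod (h (z j)))).
      pose proof (pow2_ge_0 (Cmod (phi (w j)))).
      pose proof (pow2_ge_0 (Cmod (Cminus (h (z j)) (h (w j))))).
      apply Rle_trans with (Cmod (Cminus (phi (z j)) (phi (w j))) ^ 2 * Cmod (h (z j)) ^ 2).
      { now apply Rmult_le_compat_r. }
      eapply Rle_trans; [exact T|]. unfold M3.
      assert (Cmod (phi (w j)) ^ 2 * Cmod (Cminus (h (z j)) (h (w j))) ^ 2 <= M * (M1 * Q)).
      { apply Rmult_le_compat; easy. }
      lra. }
    (* Since [t K(z, z) >= 1 / 4], the [j]-th term alone gives [sqrt(t) |h(z)| >= 2^-j t K(z, z) >=
       2^-j / 4]. *)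
    assert (V : (1 / 4) ^ j / 16 <= t j * Cmod (h (z j)) ^ 2).
    { assert (St : sqrt (t j) * sqrt (t j) = t j) by (apply sqrt_sqrt; lra).
      pose proof (sqrt_pos (t j)) as Sp. set (r := sqrt (t j)) in *.
      assert (Q4 : (1 / 4) ^ j = (1 / 2) ^ j * (1 / 2) ^ j).
      { rewrite <- Rpow_mult_distr. f_equal. field. }
      rewrite Q4. pose proof (Hpow j) as Pj. unfold c in Hlow. fold r in Hlow.
      set (a := (1 / 2) ^ j) in *. set (k := fst (K (z j) (z j))) in *.
      assert (L1 : a / 4 <= r * Cmod (h (z j))).
      { apply Rle_trans with (r * (a * r * k)).
        - replace (r * (a * r * k)) with (a * (r * r * k)) by ring. rewrite St. nra.
        - apply Rmult_le_compat_l; [easy|]. eapply Rle_trans; [exact Hlow|apply Re_le_Cmod]. }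
      rewrite <- St.
      replace (r * r * Cmod (h (z j)) ^ 2) with ((r * Cmod (h (z j))) ^ 2) by ring.
      replace (a * a / 16) with ((a / 4) ^ 2) by field.
      apply pow_incr. lra. }
    assert (P4 : 0 < (1 / 4) ^ j) by (apply pow_lt; lra).
    assert (Q16 : (1 / 16) ^ j = (1 / 4) ^ j * (1 / 4) ^ j).
    { rewrite <- Rpow_mult_distr. f_equal. field. }
    rewrite Q16 in Hq.
    assert (P3 : 0 <= M3).
    { unfold M3. pose proof (pow2_ge_0 (Cmod (phi (w j)))).
      assert (0 <= M) by lra. pose proof (Rmult_le_pos _ _ H0 P1). lra. }
    apply Rmult_le_reg_r with ((1 / 4) ^ j); [easy|].
    apply Rle_trans with (e * (t j * Cmod (h (z j)) ^ 2)).
    { replace (e / 16 * (1 / 4) ^ j) with (e * ((1 / 4) ^ j / 16)) by field.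
      apply Rmult_le_compat_l; lra. }
    apply Rle_trans with (M3 * (t j * Q)).
    { replace (e * (t j * Cmod (h (z j)) ^ 2)) with (t j * (e * Cmod (h (z j)) ^ 2)) by ring.
      replace (M3 * (t j * Q)) with (t j * (M3 * Q)) by ring.
      apply Rmult_le_compat_l; lra. }
    rewrite Rmult_assoc. now apply Rmult_le_compat_l. }
  assert (L : is_lim_seq (fun j => M3 * (1 / 4) ^ j) (M3 * 0)).
  { apply is_lim_seq_mult'; [apply is_lim_seq_const|].
    apply is_lim_seq_geom. rewrite Rabs_pos_eq; lra. }
  pose proof (is_lim_seq_le _ _ _ _ Main (is_lim_seq_const _) L) as F. simpl in F. lra.
Qed.

End Oscillation.

(** * Selection of the points and conclusion *)

Lemma is_lim_seq_eventually_lt (u : nat -> R) (l c : R) :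
  is_lim_seq u l -> l < c -> eventually (fun n => u n < c).
Proof.
  intros Hu Hlc. apply is_lim_seq_spec in Hu. assert (P : 0 < c - l) by lra.
  destruct (Hu (mkposreal _ P)) as [N HN]. exists N. intros n Hn.
  specialize (HN n Hn). simpl in HN. apply Rabs_def2 in HN. lra.
Qed.

Lemma is_lim_seq_eventually_gt (u : nat -> R) (l c : R) :
  is_lim_seq u l -> c < l -> eventually (fun n => c < u n).
Proof.
  intros Hu Hlc. apply is_lim_seq_spec in Hu. assert (P : 0 < l - c) by lra.
  destruct (Hu (mkposreal _ P)) as [N HN]. exists N. intros n Hn.
  specialize (HN n Hn). simpl in HN. apply Rabs_def2 in HN. lra.
Qed.

Lemma Clim_seq_extension (psi : C -> C) (z : nat -> C) (xi : C) :
  filterlim psi (within closed_disc (locally xi)) (locally (psi xi)) ->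
  (forall n, open_disc (z n)) -> Clim_seq z xi -> Clim_seq (fun n => psi (z n)) (psi xi).
Proof.
  intros Hpsi Hz Lz. apply Clim_seq_filterlim. apply Clim_seq_filterlim in Lz.
  apply filterlim_comp with (2 := Hpsi). intros P HP. specialize (Lz _ HP).
  unfold filtermap in *. eapply filter_imp; [|exact Lz]. intros n Hn. apply Hn.
  specialize (Hz n). unfold open_disc, closed_disc in *. lra.
Qed.

(** An inner product of modulus below 1 leaves [1 - <f z, f w>] with positive real part, and
    inversion preserves the sign of the real part. *)
Lemma kf_Re_nonneg d f z w : vnorm2 d (f z) < 1 -> vnorm2 d (f w) < 1 ->
  0 <= fst (kf d f z w).
Proof.
  intros Hz Hw. unfold kf.
  pose proof (Re_le_Cmod (cinner d (f z) (f w))) as Q.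
  pose proof (Cmod_cinner_le d (f z) (f w)) as Q'.
  destruct (cinner d (f z) (f w)) as [x y]. simpl in *.
  apply Rle_mult_inv_pos; nra.
Qed.

Theorem theorem2p4 (d : nat) (f : C -> nat -> C)
  (Hf : embedding_map d f)
  (HV : is_variety d (fun v => exists z, open_disc z /\ forall i, v i = f z i))
  (xi zeta : C) (Hxi : unit_circle xi) (Hzeta : unit_circle zeta) (Hne : xi <> zeta)
  (Heq : forall i, f xi i = f zeta i)
  (phi : C -> C) (Hphi : in_Mf d f phi)
  (psi : C -> C)
  (Hext : forall z, open_disc z -> psi z = phi z)
  (Hcont : forall z, closed_disc z ->
      filterlim psi (within closed_disc (locally z)) (locally (psi z))) :
  psi xi = psi zeta.
Proof.
  apply Classical_Prop.NNPP. intros Hpsi.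
  destruct (kernel_boundary_sequences d f xi zeta Hf Hxi Hzeta Heq)
    as (z & w & t & Hz & Hw & Ht & Lz & Lw & Kzz & Kww & Kzw).
  destruct Hf as (_ & _ & _ & _ & Hball & _).
  assert (Lpz : Clim_seq (fun n => psi (z n)) (psi xi)).
  { apply Clim_seq_extension; auto. apply Hcont. unfold closed_disc. rewrite Hxi. lra. }
  assert (Lpw : Clim_seq (fun n => psi (w n)) (psi zeta)).
  { apply Clim_seq_extension; auto. apply Hcont. unfold closed_disc. rewrite Hzeta. lra. }
  (* Half the limit of [|phi(z_n) - phi(w_n)|^2], so that it is eventually a lower bound; likewise
     [M] exceeds the limit of [|phi(w_n)|^2] by 1. *)
  set (e := Cmod (Cminus (psi xi) (psi zeta)) ^ 2 / 2).
  assert (He : 0 < e).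
  { assert (P : 0 < Cmod (Cminus (psi xi) (psi zeta))).
    { apply Cmod_gt_0. intros H. apply Hpsi.
      replace (psi xi) with (Cplus (Cminus (psi xi) (psi zeta)) (psi zeta)) by ring.
      rewrite H. ring. }
    unfold e. nra. }
  set (M := Cmod (psi zeta) ^ 2 + 1).
  set (K := kf d f) in *.
  assert (Lq : is_lim_seq (fun n => t n *
    (fst (K (z n) (z n)) + fst (K (w n) (w n)) - 2 * fst (K (z n) (w n)))) 0).
  { replace 0 with (1 / 2 + 1 / 2 - 2 * (1 / 2)) by field.
    apply is_lim_seq_ext with (fun n => t n * fst (K (z n) (z n)) +
      t n * fst (K (w n) (w n)) - 2 * (t n * fst (K (z n) (w n)))); [intros n; ring|].
    apply is_lim_seq_minus'; [now apply is_lim_seq_plus'|].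
    apply is_lim_seq_mult'; [apply is_lim_seq_const|easy]. }
  assert (Ex : forall j : nat, exists n,
    1 / 4 <= t n * fst (K (z n) (z n)) <= 1 /\
    t n * (fst (K (z n) (z n)) + fst (K (w n) (w n)) - 2 * fst (K (z n) (w n)))
      <= (1 / 16) ^ j /\
    Cmod (phi (w n)) ^ 2 <= M /\ e <= Cmod (Cminus (phi (z n)) (phi (w n))) ^ 2).
  { intros j.
    assert (P16 : 0 < (1 / 16) ^ j) by (apply pow_lt; lra).
    pose proof (is_lim_seq_eventually_gt _ _ (1 / 4) Kzz ltac:(lra)) as E1.
    pose proof (is_lim_seq_eventually_lt _ _ 1 Kzz ltac:(lra)) as E2.
    pose proof (is_lim_seq_eventually_lt _ _ _ Lq P16) as E3.
    pose proof (Clim_seq_Cmod_minus_sqr _ _ _ _ Lpw (Clim_seq_const (RtoC 0))) as L4.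
    assert (E4 := is_lim_seq_eventually_lt _ _ M L4).
    pose proof (Clim_seq_Cmod_minus_sqr _ _ _ _ Lpz Lpw) as L5.
    assert (E5 := is_lim_seq_eventually_gt _ _ e L5).
    assert (C0 : forall c, Cminus c (RtoC 0) = c) by (intros; ring).
    specialize (E4 ltac:(rewrite C0; unfold M; lra)). specialize (E5 ltac:(unfold e in *; lra)).
    destruct (filter_and _ _ E1 (filter_and _ _ E2 (filter_and _ _ E3 (filter_and _ _ E4 E5))))
      as [N HN].
    exists N. destruct (HN N (le_n N)) as (H1 & H2 & H3 & H4 & H5).
    rewrite C0 in H4. rewrite <- !Hext by auto. lra. }
  (* Choice picks for each [j] an index meeting all the conditions, in particular the prescribed
     rate [(1 / 16) ^ j], however slowly the original sequence converges. *)
  set (s := fun j => proj1_sig (constructive_indefinite_description _ (Ex j))).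
  assert (Hs := fun j => proj2_sig (constructive_indefinite_description _ (Ex j))).
  assert (Hv : forall x, open_disc x -> vnorm2 d (f x) < 1) by (intros x Hx; now apply Hball).
  refine (multiplier_no_fast_oscillation open_disc K (kf_hermitian d f)
    (kf_positive_semidefinite d f open_disc Hv) _ phi
    (fun j => z (s j)) (fun j => w (s j)) (fun j => t (s j)) M e Hphi _ _ _ _ _ _ He _);
    try (intros j; first [apply Hz | apply Hw | apply Ht | apply (Hs j)]).
  intros x y Hx Hy. apply kf_Re_nonneg; auto.
Qed.
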